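(* Let $d\ge 2$, let $Q$ be a quadratic form on $\mathbb{R}^d$, let $v\in\mathbb{R}^d$, $\rho\in\mathbb{R}$, and let $S=\{x\in\mathbb{R}^d : Q(x)+2\langle v,x\rangle=\rho\}$. Then there exists an exceptional set $\mathcal{E}=\mathcal{E}(Q,v,\rho)$ of measure zero in $\mathbb{S}^{d-1}\times\mathbb{S}^{d-1}$ with the following property: let $u_1,u_2\in\mathbb{S}^{d-1}$ be distinct directions (that is, $u_1\neq\pm u_2$) such that $Q(u_1)\neq0$, $Q(u_2)\neq 0$ and $(u_1,u_2)\notin\mathcal{E}$. If $\mu,\nu\in\mathcal{M}(S)$ satisfy $(\pi_{H_{u_1}})_*\mu=(\pi_{H_{u_1}})_*\nu$ and $(\pi_{H_{u_2}})_*\mu=(\pi_{H_{u_2}})_*\nu$, then $\mu=\nu$.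
   Context: For a measurable set $S\subseteq\mathbb{R}^d$, $\mathcal{M}(S)$ denotes the set of finite signed Borel measures supported in $S$. For $u\in\mathbb{R}^d$ with $|u|=1$, $H_u=\{x\in\mathbb{R}^d:\langle x,u\rangle=0\}$ and $\pi_{H_u}$ is the orthogonal projection of $\mathbb{R}^d$ onto $H_u$. For a Borel map $f:X\to Y$ and a measure $\mu$ on $X$, $f_*\mu$ is the push-forward, $f_*\mu(E)=\mu(f^{-1}(E))$. $\mathbb{S}^{d-1}$ is the unit sphere of $\mathbb{R}^d$, and measure zero in $\mathbb{S}^{d-1}\times\mathbb{S}^{d-1}$ refers to the product surface measure. *)

(* Defs.v *)
From HB Require Import structures.
From mathcomp Require Import all_boot all_order all_algebra.
From mathcomp Require Import all_classical all_reals all_analysis.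

Set Implicit Arguments.
Unset Strict Implicit.
Unset Printing Implicit Defensive.

Import Order.TTheory GRing.Theory Num.Theory.
Import numFieldNormedType.Exports.

Local Open Scope classical_set_scope.
Local Open Scope ring_scope.

(* Borel sigma-algebra *)
HB.instance Definition _ (R : realType) (m n : nat) :=
  isMeasurable.Build (sigma_display (@open 'M[R]_(m, n))) 'M[R]_(m, n)
   (@sigma_algebra0 _ setT _) (@sigma_algebraC _ (@open 'M[R]_(m,n)))
  (@sigma_algebra_bigcup _ setT open).

Section lebesgue_rV.
Context {R : realType}.

Lemma open_measurable_mx m n (U : set 'M[R]_(m, n)) : open U -> measurable U.
Proof. exact: sub_sigma_algebra. Qed.

Definition cons_rV n (p : measurableTypeR R * 'rV[R]_n) : 'rV[R]_n.+1 :=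
  row_mx (p.1 : R)%:M p.2.

Lemma cons_rV0 n p : @cons_rV n p 0 0 = p.1.
Proof.
by rewrite /cons_rV mxE; case: splitP => // j _; rewrite ord1 mxE.
Qed.

Lemma cons_rVS n p (i : 'I_n) : cons_rV p 0 (lift ord0 i) = p.2 0 i.
Proof.
rewrite /cons_rV mxE; case: splitP => [j|j /= [] ij]; first by rewrite ord1.
by congr (p.2 0 _); apply/val_inj; exact/esym.
Qed.

Lemma ballR_measurable (x e : R) :
  measurable (ball x e : set (measurableTypeR R)).
Proof. by rewrite ball_itv; exact: measurable_itv. Qed.

Lemma measurable_cons_rV n :
  measurable_fun [set: measurableTypeR R * 'rV[R]_n] (@cons_rV n).
Proof.
apply: (measurability (@open 'rV[R]_n.+1)); first by [].
move=> _ [U oU <-].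
rewrite setTI.
pose B (q : rat * 'rV[rat]_n * nat) : set (measurableTypeR R * 'rV[R]_n) :=
  (ball (ratr q.1.1 : R) q.2.+1%:R^-1) `*`
  (ball (map_mx ratr q.1.2 : 'rV[R]_n) q.2.+1%:R^-1).
pose I := [set q | B q `<=` @cons_rV n @^-1` U].
suff -> : @cons_rV n @^-1` U = \bigcup_(q in I) B q.
  rewrite bigcup_mkcond; apply: countable_bigcupT_measurable => // q.
  case: ifP => // _.
  apply: measurableX; first exact: ballR_measurable.
  by apply: open_measurable_mx; apply: ball_open; rewrite invr_gt0.
rewrite eqEsubset; split => [[x y] /= Uxy|p [q Iq Bqp]]; last exact: Iq.
have /nbhs_ballP[e /= e0 eU] := open_nbhs_nbhs (conj oU Uxy).
have [k ke] : exists k : nat, 2 * k.+1%:R^-1 < e.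
  have [k _ /(_ _ (leqnn k)) kP] :=
    near_infty_natSinv_lt (PosNum (divr_gt0 e0 (ltr0Sn R 1))).
  by exists k; rewrite mulrC -ltr_pdivlMr //; exact: kP.
have k0 : 0 < k.+1%:R^-1 :> R by rewrite invr_gt0.
have ratP (z : R) : exists q : rat, `|z - ratr q| < k.+1%:R^-1.
  have /rat_in_itvoo[q] : z < z + k.+1%:R^-1 by rewrite ltrDl.
  by rewrite inE /= => /andP[zq qz]; exists q; rewrite ltr_distlC;
    apply/andP; split; rewrite ?(lt_trans _ zq)// ?gtrBl //; rewrite ltrBlDr // in qz *.
have [qx xq] := ratP x.
have [qy yq] : exists q : 'rV[rat]_n,
    forall i, `|y 0 i - ratr (q 0 i)| < k.+1%:R^-1.
  have /choice[f fP] := fun i => ratP (y 0 i).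
  by exists (\row_i f i) => i; rewrite mxE.
exists (qx, qy, k); last first.
  split; rewrite /=; first by rewrite /ball/= distrC.
  by split => // i j; rewrite ord1 mxE /ball/= distrC.
move=> [x' y'] [/= Bx [_ By]]; apply: eU; split => // i j.
rewrite ord1; apply: lt_trans ke; rewrite mulr_natl mulr2n.
case: (unliftP ord0 j) => [j' ->|->]; rewrite ?cons_rV0 ?cons_rVS /=.
  apply: le_lt_trans (ler_distD (ratr (qy 0 j')) _ _) _; rewrite ltrD//.
  by have := By 0 j'; rewrite mxE.
by apply: le_lt_trans (ler_distD (ratr qx) _ _) _; rewrite ltrD.
Qed.

Definition uncons_rV n (v : 'rV[R]_n.+1) : measurableTypeR R * 'rV[R]_n :=
  (v 0 0, \row_i v 0 (lift ord0 i)).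

Lemma cons_rVK n : cancel (@cons_rV n) (@uncons_rV n).
Proof.
move=> [x y]; congr pair; first exact: cons_rV0.
by apply/rowP => i; rewrite mxE cons_rVS.
Qed.

Lemma measurable_uncons_rV n : measurable_fun [set: 'rV[R]_n.+1] (@uncons_rV n).
Proof.
apply/measurable_fun_pairP; split.
  pose G : set (set (measurableTypeR R)) := @measurable_realfun.RGenOpens.G R.
  apply: (measurability G);
    first exact: measurable_realfun.RGenOpens.measurableE.
  move=> _ [U [a [b UE]] <-].
  have {UE}oU : open U by rewrite UE; exact: interval_open.
  rewrite setTI; apply: open_measurable_mx.
  by apply: open_comp oU => v _; exact: coord_continuous.
apply: (measurability (@open 'rV[R]_n)); first by [].
move=> _ [U oU <-]; rewrite setTI; apply: open_measurable_mx.
apply: open_comp oU => v _ /= A /nbhs_ballP[e e0 eA].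
apply/nbhs_ballP; exists e => // w [_ vw]; apply: eA; split => // i j.
by rewrite !mxE; exact: vw.
Qed.

(* Lebesgue measure on R^n, by iterating the product with Lebesgue measure on R;
   see lebesgue_rV_box for its value on boxes. *)
Definition lebesgue_step n
    (mu : {sigma_finite_measure set 'rV[R]_n -> \bar R}) :
    set 'rV[R]_n.+1 -> \bar R :=
  pushforward (@lebesgue_measure R \x mu)%E (@cons_rV n).

Section lebesgue_step.
Context n (mu : {sigma_finite_measure set 'rV[R]_n -> \bar R}).

Let P : {measure set 'rV[R]_n.+1 -> \bar R} :=
  @measure_function_pushforward__canonical__measure_function_Measure _ _ _ _ _
    (@lebesgue_measure R \x mu)%E (@cons_rV n) (@measurable_cons_rV n).

HB.instance Definition _ := isMeasure.Build _ _ _ (lebesgue_step mu)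
  (measure0 P) (measure_ge0 P) (@measure_semi_sigma_additive _ _ _ P).

Let step_sigma_finite : sigma_finite setT (lebesgue_step mu).
Proof.
pose L : {sigma_finite_measure set (measurableTypeR R) -> \bar R} :=
  @lebesgue_measure R.
have /sigma_finiteP[F [TF ndF Foo]] := sigma_finiteT L.
have /sigma_finiteP[G [TG ndG Goo]] := sigma_finiteT mu.
exists (fun k => @uncons_rV n @^-1` (F k `*` G k)).
  rewrite -preimage_bigcup -[LHS](preimage_setT (@uncons_rV n));
    congr (_ @^-1` _).
  rewrite -setXTT TF TG predeqE => -[x y]; split.
    move=> [/= [i _ Fx] [k _ Gy]]; exists (maxn i k) => //; split.
    - by move: x Fx; exact/subsetPset/ndF/leq_maxl.
    - by move: y Gy; exact/subsetPset/ndG/leq_maxr.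
  by move=> [i _ []/= ? ?]; split; exists i.
move=> k; have [mF Fk] := Foo k; have [mG Gk] := Goo k; split.
  by rewrite -[X in measurable X]setTI; apply: measurable_uncons_rV => //;
    exact: measurableX.
rewrite /lebesgue_step /pushforward -comp_preimage (_ : _ \o _ = id); last first.
  by apply/funext => p /=; rewrite cons_rVK.
by rewrite preimage_id product_measure1E// lte_mul_pinfty// ge0_fin_numE.
Qed.

HB.instance Definition _ :=
  Measure_isSigmaFinite.Build _ _ _ (lebesgue_step mu) step_sigma_finite.

End lebesgue_step.

Fixpoint lebesgue_rV n : {sigma_finite_measure set 'rV[R]_n -> \bar R} :=
  if n is n'.+1 then lebesgue_step (lebesgue_rV n') else \d_(0 : 'rV[R]_0).

Lemma preimage_cons_rV_box n (A : 'I_n.+1 -> set (measurableTypeR R)) :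
  @cons_rV n @^-1` [set v | forall i, A i (v 0 i)] =
  A ord0 `*` [set v : 'rV[R]_n | forall i, A (lift ord0 i) (v 0 i)].
Proof.
apply/seteqP; split => -[x y] /=.
  move=> Axy; split; first by have := Axy 0; rewrite cons_rV0.
  by move=> i; have := Axy (lift ord0 i); rewrite cons_rVS.
move=> [Ax Ay] i; case: (unliftP ord0 i) => [j ->|->]; last by rewrite cons_rV0.
by rewrite cons_rVS; exact: Ay.
Qed.

Lemma measurable_box n (A : 'I_n -> set (measurableTypeR R)) :
  (forall i, measurable (A i)) ->
  measurable [set v : 'rV[R]_n | forall i, A i (v 0 i)].
Proof.
elim: n A => [A _|n IH A mA].
  by rewrite (_ : mkset _ = setT)//; apply/seteqP; split => // v _ [].
rewrite (_ : mkset _ = @uncons_rV n @^-1` (A ord0 `*`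
    [set v : 'rV[R]_n | forall i, A (lift ord0 i) (v 0 i)])); last first.
  rewrite -preimage_cons_rV_box -comp_preimage (_ : _ \o _ = id)//.
  apply/funext => v /=; apply/rowP => i; case: (unliftP ord0 i) => [j ->|->].
    by rewrite cons_rVS mxE.
  by rewrite cons_rV0.
rewrite -[X in measurable X]setTI; apply: measurable_uncons_rV => //.
exact: (measurableX (mA _) (IH _ (fun i => mA (lift ord0 i)))).
Qed.

Lemma lebesgue_rV_box n (A : 'I_n -> set (measurableTypeR R)) :
  (forall i, measurable (A i)) ->
  lebesgue_rV n [set v | forall i, A i (v 0 i)] =
  (\prod_(i < n) lebesgue_measure (A i))%E.
Proof.
elim: n A => [A _|n IH A mA].
  by rewrite big_ord0 /= diracE mem_set// => -[].
rewrite big_ord_recl -IH//= /lebesgue_step /pushforward preimage_cons_rV_box.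
rewrite product_measure1E//.
exact: (measurable_box (fun i => mA (lift ord0 i))).
Qed.

End lebesgue_rV.

Section euclidean.
Context {R : realType} {d : nat}.
Implicit Types u v x y : 'rV[R]_d.

Definition dotp u v : R := \sum_(i < d) u 0 i * v 0 i.

(* The library norm `|x| on row vectors is the sup norm, whence this Euclidean
   norm. *)
Definition enorm x : R := Num.sqrt (dotp x x).

Definition unit_sphere : set 'rV[R]_d := [set u | enorm u = 1].

Definition hyperplane u : set 'rV[R]_d := [set x | dotp x u = 0].

(* Orthogonal projection onto hyperplane u when u is a unit vector
   (proj_hyperplaneP), seen as a map into R^d rather than onto its image. *)
Definition proj_hyperplane u x : 'rV[R]_d := x - dotp x u *: u.

Definition quadratic_form (Q : 'rV[R]_d -> R) : Prop :=
  exists2 A : 'M[R]_d, A^T = A & forall x, Q x = (x *m A *m x^T) 0 0.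

Definition quadric (Q : 'rV[R]_d -> R) v (rho : R) : set 'rV[R]_d :=
  [set x | Q x + 2 * dotp v x = rho].

Lemma dotpC u v : dotp u v = dotp v u.
Proof. by apply: eq_bigr => i _; rewrite mulrC. Qed.

Lemma dotpBl u v x : dotp (u - v) x = dotp u x - dotp v x.
Proof.
by rewrite /dotp -sumrB; apply: eq_bigr => i _; rewrite !mxE mulrBl.
Qed.

Lemma dotpZl (a : R) u v : dotp (a *: u) v = a * dotp u v.
Proof. by rewrite /dotp mulr_sumr; apply: eq_bigr => i _; rewrite mxE mulrA. Qed.

Lemma dotp_ge0 x : 0 <= dotp x x.
Proof. by apply: sumr_ge0 => i _; rewrite -expr2 sqr_ge0. Qed.

Lemma enorm_ge0 x : 0 <= enorm x.
Proof. exact: sqrtr_ge0. Qed.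

Lemma enormZ (a : R) x : enorm (a *: x) = `|a| * enorm x.
Proof.
by rewrite /enorm dotpZl dotpC dotpZl mulrA -expr2 sqrtrM ?sqr_ge0// sqrtr_sqr.
Qed.

Lemma ler_coord_enorm x i : `|x 0 i| <= enorm x.
Proof.
rewrite -sqrtr_sqr ler_sqrt ?dotp_ge0// /dotp (bigD1 i)//= -expr2 lerDl.
by apply: sumr_ge0 => j _; rewrite -expr2 sqr_ge0.
Qed.

Lemma proj_hyperplaneP u x : unit_sphere u ->
  hyperplane u (proj_hyperplane u x) /\
  forall y, hyperplane u y -> dotp (x - proj_hyperplane u x) y = 0.
Proof.
move=> u1; have uu : dotp u u = 1.
  by rewrite -(sqr_sqrtr (dotp_ge0 u)) -/(enorm u) u1 expr1n.
split.
  by rewrite /hyperplane/= /proj_hyperplane dotpBl dotpZl uu mulr1 subrr.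
move=> y yu; rewrite /proj_hyperplane opprB addrC subrK dotpZl.
by rewrite (dotpC u y) yu mulr0.
Qed.

Let continuous_sum (F : 'I_d -> 'rV[R]_d -> R) :
  (forall i, continuous (F i)) -> continuous (fun x => \sum_(i < d) F i x).
Proof.
by move=> cF; apply: continuous_big => [|i _]; [exact: add_continuous|exact: cF].
Qed.

Lemma continuous_enorm : continuous (enorm : 'rV[R]_d -> R).
Proof.
move=> x; apply: continuous_comp; last exact: sqrt_continuous.
apply: continuous_sum => i {}x; have cx := @coord_continuous R 1 d 0 i x.
exact: (cvgM cx cx).
Qed.

Lemma measurable_proj_hyperplane u :
  measurable_fun [set: 'rV[R]_d] (proj_hyperplane u).
Proof.
apply: (measurability (@open 'rV[R]_d)); first by [].
move=> _ [U oU <-]; rewrite setTI; apply: open_measurable_mx.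
apply: open_comp oU => x _; have cu : continuous (fun y => dotp y u).
  apply: continuous_sum => i y.
  exact: (cvgM (@coord_continuous R 1 d 0 i y) (cvg_cst (u 0 i))).
exact: (cvgB cvg_id (cvgZr_tmp (cu x))).
Qed.

End euclidean.

Section surface_measure.
Context {R : realType} (d : nat).
Implicit Type A : set 'rV[R]_d.

Definition cone A : set 'rV[R]_d :=
  [set r *: u | r in `]0, 1] & u in A `&` unit_sphere].

(* Surface measure of the unit sphere, seen as a Borel measure on R^d
   concentrated on the sphere: sigma(A) = d * Leb {r u | 0 < r <= 1, u in A},
   as in integration in polar coordinates. *)
Definition surface_measure A : \bar R := (d%:R%:E * lebesgue_rV d (cone A))%E.

Let D : set 'rV[R]_d := [set x | 0 < enorm x <= 1].
Let normalize (x : 'rV[R]_d) : 'rV[R]_d := (enorm x)^-1 *: x.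

Let measurable_D : measurable D.
Proof.
have -> : D = (enorm @^-1` `]0, +oo[) `\` (enorm @^-1` `]1, +oo[).
  apply/seteqP; split => x; rewrite /D /= !in_itv/= !andbT.
    by move=> /andP[-> x1]; split => //; apply/negP; rewrite -leNgt.
  by move=> [-> /negP]; rewrite -leNgt.
apply: measurableD; apply: open_measurable_mx;
  apply: open_comp => [x _|]; by [exact: continuous_enorm|exact: rray_open].
Qed.

Let measurable_normalize : measurable_fun D normalize.
Proof.
apply: (measurability (@open 'rV[R]_d)); first by [].
move=> _ [U oU <-].
pose V : set 'rV[R]_d := (enorm @^-1` `]0, +oo[) `&` (normalize @^-1` U).
rewrite (_ : D `&` _ = D `&` V); last first.
  apply/seteqP; split => x []; rewrite /V /D /= ?in_itv/= ?andbT.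
    by move=> /[dup] xD /andP[x0 _] ?; split.
  by move=> ? [].
apply: measurableI => //; apply: open_measurable_mx.
rewrite openE => x [/=]; rewrite in_itv/= andbT => x0 Ux.
apply: filterI.
  apply: continuous_enorm; apply: open_nbhs_nbhs; split; first exact: rray_open.
  by rewrite /= in_itv/= x0.
suff : normalize y @[y --> x] --> normalize x by apply; exact: open_nbhs_nbhs.
have ex0 : enorm x != 0 by rewrite gt_eqF.
exact: (cvgZ (cvgV ex0 (@continuous_enorm R d x)) cvg_id).
Qed.

Let coneE A : cone A = D `&` normalize @^-1` A.
Proof.
apply/seteqP; split => [_ [r + [u [Au u1] <-]]|x [/= /andP[x0 x1] Ax]].
  rewrite /= in_itv/= => /andP[r0 r1].
  have ru : enorm (r *: u) = r by rewrite enormZ u1 mulr1 gtr0_norm.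
  split; first by rewrite /D/= ru r0.
  by rewrite /normalize /= ru scalerA mulVf ?gt_eqF// scale1r.
exists (enorm x); first by rewrite /= in_itv/= x0.
exists (normalize x); last by rewrite /normalize scalerA mulfV ?gt_eqF// scale1r.
split => //; rewrite /unit_sphere/= enormZ gtr0_norm ?invr_gt0//.
by rewrite mulVf ?gt_eqF.
Qed.

Lemma measurable_cone A : measurable A -> measurable (cone A).
Proof. by move=> mA; rewrite coneE; exact: measurable_normalize. Qed.

Let surface0 : surface_measure set0 = 0%E.
Proof. by rewrite /surface_measure coneE preimage_set0 setI0 measure0 mule0. Qed.

Let surface_ge0 A : (0 <= surface_measure A)%E.
Proof. by rewrite mule_ge0// lee_fin. Qed.

Let surface_semi_sigma_additive : semi_sigma_additive surface_measure.
Proof.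
move=> F mF tF mUF; rewrite /surface_measure coneE preimage_bigcup setI_bigcupr.
under [X in X @ _]eq_fun do rewrite -ge0_sume_distrr//.
apply: cvgeZl => //.
under [X in X @ _]eq_fun do under eq_bigr do rewrite coneE.
apply: measure_semi_sigma_additive.
- by move=> n; rewrite -coneE; exact: measurable_cone.
- apply/trivIsetP => /= i j _ _ ij; rewrite setIACA setIid -preimage_setI.
  by move/trivIsetP : tF => /(_ _ _ _ _ ij) ->//; rewrite preimage_set0 setI0.
- by rewrite -setI_bigcupr -preimage_bigcup -coneE; exact: measurable_cone.
Qed.

HB.instance Definition _ := isMeasure.Build _ _ _ surface_measure
  surface0 surface_ge0 surface_semi_sigma_additive.

Let surface_finite : fin_num_fun surface_measure.
Proof.
apply: lty_fin_num_fun; rewrite /surface_measure lte_mul_pinfty//.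
pose A (i : 'I_d) : set (measurableTypeR R) := `[-1, 1]%classic.
have mA i : measurable (A i) by exact: measurable_itv.
apply: (@le_lt_trans _ _ (lebesgue_rV d [set v | forall i, A i (v 0 i)])).
  apply: le_measure; rewrite ?inE.
  - exact: measurable_cone measurableT.
  - exact: measurable_box mA.
  - rewrite coneE => x [/andP[_ x1] _] i.
    by rewrite /A /= in_itv/= -ler_norml (le_trans (ler_coord_enorm x i) x1).
rewrite lebesgue_rV_box// (eq_bigr (fun=> 2%:E)) => [|i _]; last first.
  by rewrite lebesgue_measure_itv/= lte_fin gtrN// -EFinB opprK.
by rewrite prodEFin ltry.
Qed.

HB.instance Definition _ :=
  Measure_isFinite.Build _ _ _ surface_measure surface_finite.

End surface_measure.

Arguments surface_measure {R} d A.

Section charges.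
Context d (T : measurableType d) {R : realType}.

(* i.e. the total variation of m vanishes on the complement of S *)
Definition supported_in (m : set T -> \bar R) (S : set T) : Prop :=
  forall A, measurable A -> A `<=` ~` S -> m A = 0%E.

(* Equality as measures: the value of a charge on a non-measurable set is junk. *)
Definition charge_eq (m1 m2 : set T -> \bar R) : Prop :=
  forall A, measurable A -> m1 A = m2 A.

End charges.

(* Main.v *)
Require Import Defs.
From HB Require Import structures.
From mathcomp Require Import all_boot all_order all_algebra.
From mathcomp Require Import all_classical all_reals all_analysis.
From mathcomp Require Import measurable_realfun.
From mathcomp Require Import ring lra.
Import Order.TTheory GRing.Theory Num.Theory.
Import numFieldNormedType.Exports.
Local Open Scope classical_set_scope.
Local Open Scope ring_scope.

Set Implicit Arguments.
Unset Strict Implicit.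
Unset Printing Implicit Defensive.

(** Why the theorem is true.  Let [F x = Q x + 2 <v, x>], so that the quadric is
    a level set of [F].  When [Q u != 0], the restriction of [F] to a line of
    direction [u] is a polynomial of degree 2, so the line meets the quadric in
    at most two points, and they are exchanged by an affine reflection [T_u] of
    the whole space.  A measurable subset of the quadric that is invariant under
    [T_u] is the trace of a cylinder of direction [u] with measurable base;
    hence, if two charges [mu] and [nu] on the quadric have the same projection
    along [u], they agree on invariant sets, and [T_u] reverses the charge
    [mu - nu] ([quadric_refl_anti]).

    It remains to show that a finite signed measure that is reversed by
    [T1 = T_(u1)] and by [T2 = T_(u2)] vanishes
    ([eq_measure_two_reflections]).  Let [I f] be the integral of a Lipschitz
    function [f] with bounded support.  Then [I (f o T1) = - I f], and [I] is
    invariant under the affine map [G = T2 o T1], which moves points in planes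
    parallel to [u1] and [u2].  The linear part of [G] on these planes has
    determinant 1 and trace [4 B(u1,u2)^2 / (Q(u1) Q(u2)) - 2], where [B] is the
    bilinear form of [Q].

    If this trace is equal to 2 or has an absolute value larger than 2, each
    orbit of [G] either leaves all bounded sets or is asymptotic to the mirror of
    [T1].  In both cases [g = f - f o T1] tends to 0 along the orbit.  Since
    [2 I f = I g = I (g o G^k)] for all [k], bounded convergence gives [I f = 0]
    ([integral_diff_wandering]).

    Otherwise, the trace is [2 cos th] with [0 < th <= pi], and [G] acts on each
    plane as a rotation of angle [th] in suitable coordinates, in which [T1] is
    an orthogonal symmetry.  If [th] is not a rational multiple of [2 pi], then
    by Kronecker's theorem the orbit of [x] passes close to [T1 x] and from then
    on follows the orbit of [T1 x], so [f] has asymptotically the same averages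
    along both orbits.  These averages integrate to [I f] and [- I f] and
    therefore [I f = 0] ([integral_diff_shadow]).

    The exceptional set consists of the pairs for which [th] is a rational
    multiple of [2 pi] (and the trace is not 2).  For fixed [u1] with
    [Q u1 != 0] and fixed [th], the equation on [u2] is the vanishing of a
    quadratic form that is not zero at [u1]; so its zeros form a null cone, and
    Fubini's theorem shows that the exceptional set is null
    ([exceptional_pairs_null]). *)

(** * Integrals with respect to a difference of two finite measures *)

Section integral_difference.
Context {dT : measure_display} {T : measurableType dT} {R : realType}.
Variables alpha beta : {finite_measure set T -> \bar R}.
Implicit Types f g : T -> R.

(** The bounded measurable functions, which are integrable for all finite
    measures. *)
Definition bounded_measurable f :=
  measurable_fun setT f /\ exists M, forall x, `|f x| <= M.

Lemma bounded_measurable_integrable (mu : {finite_measure set T -> \bar R}) f :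
  bounded_measurable f -> mu.-integrable setT (EFin \o f).
Proof.
move=> [mf [M fM]]; apply: measurable_bounded_integrable => //.
  by rewrite -ge0_fin_numE// fin_num_measure.
exists M; split; first exact: num_real.
by move=> K MK x _; apply: le_trans (fM x) (ltW MK).
Qed.

Lemma bounded_measurableD f g : bounded_measurable f -> bounded_measurable g ->
  bounded_measurable (f \+ g).
Proof.
move=> [mf [M fM]] [mg [N gN]]; split; first exact: measurable_funD.
by exists (M + N) => x; rewrite (le_trans (ler_normD _ _))// lerD.
Qed.

Lemma bounded_measurableB f g : bounded_measurable f -> bounded_measurable g ->
  bounded_measurable (f \- g).
Proof.
move=> [mf [M fM]] [mg [N gN]]; split; first exact: measurable_funB.
by exists (M + N) => x; rewrite (le_trans (ler_normB _ _))// lerD.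
Qed.

Lemma bounded_measurableZ (c : R) f : bounded_measurable f ->
  bounded_measurable (fun x => c * f x).
Proof.
move=> [mf [M fM]]; split; first exact: measurable_funM.
by exists (`|c| * M) => x; rewrite normrM ler_wpM2l.
Qed.

Lemma bounded_measurable_sum n (F : nat -> T -> R) :
  (forall k, bounded_measurable (F k)) ->
  bounded_measurable (fun x => \sum_(k < n) F k x).
Proof.
move=> bF; elim: n => [|n IH].
  under eq_fun do rewrite big_ord0.
  by split => //; exists 0 => x; rewrite normr0.
under eq_fun do rewrite big_ord_recr /=.
exact: (bounded_measurableD IH (bF n)).
Qed.

Lemma bounded_measurable_comp f (t : T -> T) :
  measurable_fun setT t -> bounded_measurable f -> bounded_measurable (f \o t).
Proof.
move=> mt [mf [M fM]]; split; first exact: measurableT_comp.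
by exists M => x; exact: fM.
Qed.

(** The integral of [f] with respect to the signed measure [alpha - beta]. *)
Definition integral_diff f : R :=
  \int[alpha]_x f x - \int[beta]_x f x.

Lemma integral_diffD f g : bounded_measurable f -> bounded_measurable g ->
  integral_diff (f \+ g) = integral_diff f + integral_diff g.
Proof.
move=> bf bg; rewrite /integral_diff !RintegralD//;
  try exact: bounded_measurable_integrable.
by rewrite opprD addrACA.
Qed.

Lemma integral_diffZ (c : R) f : bounded_measurable f ->
  integral_diff (fun x => c * f x) = c * integral_diff f.
Proof.
move=> bf; rewrite /integral_diff !RintegralZl ?mulrBr//;
  exact: bounded_measurable_integrable.
Qed.

Lemma integral_diffB f g : bounded_measurable f -> bounded_measurable g ->
  integral_diff (f \- g) = integral_diff f - integral_diff g.
Proof.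
move=> bf bg; rewrite /integral_diff !RintegralB//;
  try exact: bounded_measurable_integrable.
by ring.
Qed.

Lemma integral_diff_sum n (F : nat -> T -> R) :
  (forall k, bounded_measurable (F k)) ->
  integral_diff (fun x => \sum_(k < n) F k x) = \sum_(k < n) integral_diff (F k).
Proof.
move=> bF; elim: n => [|n IH].
  under eq_fun do rewrite big_ord0.
  rewrite big_ord0 /integral_diff /Rintegral.
  by rewrite !integral0 subrr.
under eq_fun do rewrite big_ord_recr /=.
rewrite big_ord_recr /= -IH -integral_diffD//.
exact: bounded_measurable_sum.
Qed.

(** Bounded convergence. *)
Lemma integral_diff_cvg0 (F : nat -> T -> R) (M : R) :
  (forall k, measurable_fun setT (F k)) -> (forall k x, `|F k x| <= M) ->
  (forall x, F k x @[k --> \oo] --> 0) ->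
  integral_diff (F k) @[k --> \oo] --> 0.
Proof.
move=> mF FM F0.
suff H (mu : {finite_measure set T -> \bar R}) :
    (\int[mu]_x F k x) @[k --> \oo] --> 0.
  by rewrite -[X in _ --> X](subrr 0); apply: cvgB; exact: H.
have [] := @dominated_convergence _ T R mu setT measurableT
  (fun k => EFin \o F k) (cst 0%:E) (cst M%:E).
- by move=> k; exact/measurable_EFinP.
- by [].
- apply: aeW => x _ /=.
  by apply: cvg_EFin; [near=> k|exact: F0].
- apply: (@bounded_measurable_integrable mu (cst M)); split => //.
  by exists `|M|.
- by apply: aeW => x k _; rewrite /= lee_fin.
move=> _ _; rewrite integral0 => H.
by apply: (@fine_cvg _ _ _ _ _ 0).
Unshelve. all: by end_near. Qed.

(** If [t] reverses [alpha - beta], then composition with [t] changes the sign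
    of integrals. *)
Lemma integral_diff_anti (t : T -> T) f : measurable_fun setT t ->
  (forall A, measurable A ->
    (alpha A + alpha (t @^-1` A) = beta A + beta (t @^-1` A))%E) ->
  bounded_measurable f -> integral_diff (f \o t) = - integral_diff f.
Proof.
move=> mt E bf; have bft := bounded_measurable_comp mt bf.
have H (mu : {finite_measure set T -> \bar R}) :
  (\int[mu]_x (f x)%:E + \int[mu]_x (f (t x))%:E)%E =
  (\int[mu]_x f x + \int[mu]_x f (t x))%:E.
  rewrite EFinD /Rintegral !fineK//.
    apply: integrable_fin_num => //.
    exact: (bounded_measurable_integrable mu bft).
  apply: integrable_fin_num => //.
  exact: (bounded_measurable_integrable mu bf).
pose P (mu : {finite_measure set T -> \bar R}) : {measure set T -> \bar R} :=
  @measure_function_pushforward__canonical__measure_function_Measure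
    _ _ _ _ _ mu t mt.
have K (mu : {finite_measure set T -> \bar R}) :
  (\int[measure_add mu (P mu)]_x (f x)%:E =
   \int[mu]_x (f x)%:E + \int[mu]_x (f (t x))%:E)%E.
  have mf : measurable_fun setT (EFin \o f) by apply/measurable_EFinP; case: bf.
  have i1 := bounded_measurable_integrable mu bf.
  have i2 := bounded_measurable_integrable mu bft.
  have i3 := integrable_pushforward mt mf i2 measurableT.
  by rewrite integral_measure_add//; congr (_ + _)%E; exact: integral_pushforward.
(* the hypothesis is the equality of [alpha + t_* alpha] and
   [beta + t_* beta] *)
have : (\int[measure_add alpha (P alpha)]_x (f x)%:E =
        \int[measure_add beta (P beta)]_x (f x)%:E)%E.
  apply: eq_measure_integral => A mA _.
  transitivity (alpha A + P alpha A)%E; first exact: measure_addE.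
  transitivity (beta A + P beta A)%E; first exact: E.
  by rewrite -measure_addE.
rewrite !K !H => -[] /eqP; rewrite -subr_eq0 /integral_diff => /eqP h.
by apply/eqP; rewrite -subr_eq0 opprK -h; apply/eqP => /=; ring.
Qed.

End integral_difference.

(** * Test functions determine finite measures *)

Section test_functions.
Context {R : realType} {d : nat}.
Implicit Types (x y : 'rV[R]_d) (f : 'rV[R]_d -> R).

Lemma continuous_measurable_real f : continuous f -> measurable_fun setT f.
Proof.
move=> cf; pose G : set (set (measurableTypeR R)) := @RGenOpens.G R.
apply: (measurability G); first exact: RGenOpens.measurableE.
move=> _ [U [a [b UE]] <-]; rewrite setTI; apply: open_measurable_mx.
by apply: open_comp => [x _|]; [exact: cf|rewrite UE; exact: interval_open].
Qed.

Lemma continuous_measurable_rV (g : 'rV[R]_d -> 'rV[R]_d) :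
  continuous g -> measurable_fun setT g.
Proof.
move=> cg; apply: (measurability (@open 'rV[R]_d)); first by [].
move=> _ [U oU <-]; rewrite setTI; apply: open_measurable_mx.
by apply: open_comp oU => x _; exact: cg.
Qed.

Lemma continuous_sum n (F : 'I_n -> 'rV[R]_d -> R) :
  (forall i, continuous (F i)) -> continuous (fun x => \sum_(i < n) F i x).
Proof.
by move=> cF; apply: continuous_big => [|i _]; [exact: add_continuous|exact: cF].
Qed.

Lemma continuous_dotp u : continuous (fun x => dotp x u).
Proof.
rewrite /dotp; apply: continuous_sum => i x.
exact: (cvgM (@coord_continuous R 1 d 0 i x) (cvg_cst (u 0 i))).
Qed.

(** Lipschitz functions with values in [[0, 1]] and bounded support. *)
Definition test_function f :=
  [/\ exists K, forall x y, `|f x - f y| <= K * `|x - y|,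
      forall x, 0 <= f x <= 1
    & exists M, forall x, M < `|x| -> f x = 0].

Lemma lipschitz_continuous f K :
  (forall x y, `|f x - f y| <= K * `|x - y|) -> continuous f.
Proof.
move=> fK x A /nbhs_ballP[e /= e0 eA].
have K1 : 0 < `|K| + 1 by rewrite ltr_wpDl.
apply/nbhs_ballP; exists (e / (`|K| + 1)); first exact: divr_gt0.
move=> y; rewrite mx_norm_ball /ball_/= => xy; apply: eA; rewrite /ball/=.
apply: le_lt_trans (fK x y) _.
apply: (@le_lt_trans _ _ ((`|K| + 1) * `|x - y|)).
  by rewrite ler_wpM2r// (le_trans (ler_norm _))// lerDl.
by rewrite mulrC -ltr_pdivlMr.
Qed.

Lemma test_function_bounded_measurable f :
  test_function f -> bounded_measurable f.
Proof.
move=> [[K fK] f01 _]; split.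
  by apply: continuous_measurable_real; exact: lipschitz_continuous fK.
by exists 1 => x; have /andP[f0 f1] := f01 x; rewrite ger0_norm.
Qed.

(** The function [min (1, m * dist (x, ~` U))]; the element 1 in the set also
    makes the infimum meaningful when [~` U] is empty. *)
Definition tent (U : set 'rV[R]_d) (m : R) x : R :=
  inf ([set 1] `|` [set m * `|x - y| | y in ~` U]).

Section tent.
Variables (U : set 'rV[R]_d) (m : R).
Hypothesis m0 : 0 <= m.

Let lb0 x : lbound ([set 1] `|` [set m * `|x - y| | y in ~` U]) 0.
Proof. by move=> _ [->//|[y _ <-]]; rewrite mulr_ge0. Qed.

Let has_lb x : has_lbound ([set 1] `|` [set m * `|x - y| | y in ~` U]).
Proof. by exists 0. Qed.

Let ne x : ([set 1] `|` [set m * `|x - y| | y in ~` U]) !=set0.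
Proof. by exists 1; left. Qed.

Lemma tent_ge0 x : 0 <= tent U m x.
Proof. exact: lb_le_inf. Qed.

Lemma tent_le1 x : tent U m x <= 1.
Proof. by apply: ge_inf => //; left. Qed.

Lemma tent_le x y : ~ U y -> tent U m x <= m * `|x - y|.
Proof. by move=> Uy; apply: ge_inf => //; right; exists y. Qed.

Lemma tent_out x : ~ U x -> tent U m x = 0.
Proof.
move=> Ux; apply/eqP; rewrite eq_le tent_ge0 andbT.
by rewrite (le_trans (tent_le x Ux))// subrr normr0 mulr0.
Qed.

Lemma tent_in x e : 1 <= m * e -> ball x e `<=` U -> tent U m x = 1.
Proof.
move=> me xU; apply/eqP; rewrite eq_le tent_le1 /=.
apply: lb_le_inf => // _ [->//|[y Uy <-]].
rewrite (le_trans me)// ler_wpM2l// leNgt; apply/negP => xy.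
by apply: Uy; apply: xU; rewrite mx_norm_ball.
Qed.

Lemma tent_lipschitz x y : `|tent U m x - tent U m y| <= m * `|x - y|.
Proof.
suff H a b : tent U m a - m * `|a - b| <= tent U m b.
  by rewrite ler_norml; apply/andP; split; have := H x y; have := H y x;
    rewrite (distrC y); lra.
apply: lb_le_inf => // _ [->|[z Uz <-]].
  by rewrite lerBlDr (le_trans (tent_le1 a))// lerDl mulr_ge0.
rewrite lerBlDr (le_trans (tent_le a Uz))// -mulrDr ler_wpM2l//.
by rewrite [leRHS]addrC ler_distD.
Qed.

End tent.

(** Finite measures on [R^d] are determined by the integrals of the
    Lipschitz functions with bounded support. *)
Lemma eq_measure_test_function
    (alpha beta : {finite_measure set 'rV[R]_d -> \bar R}) :
  (forall f, test_function f -> integral_diff alpha beta f = 0) ->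
  forall A, measurable A -> alpha A = beta A.
Proof.
move=> H; apply: (measure_unique (@open 'rV[R]_d) (fun=> setT)) => //.
- by move=> A B; exact: openI.
- by move=> _; exact: openT.
- by rewrite bigcup_const.
- move=> U oU.
  (* intersecting [U] with balls makes the supports bounded *)
  pose V m := U `&` ball (0 : 'rV[R]_d) m%:R.
  pose F m := \1_U \- tent (V m) m%:R.
  have mU : measurable U by exact: open_measurable_mx.
  have bU : bounded_measurable (\1_U : _ -> R).
    split; first exact: measurable_indic.
    by exists 1 => x; rewrite indicE; case: (_ \in _); rewrite ?normr1 ?normr0.
  have tV m : test_function (tent (V m) m%:R).
    split.
    - by exists m%:R => x y; exact: tent_lipschitz.
    - by move=> x; rewrite tent_ge0// tent_le1.
    - exists m%:R => x mx; apply: tent_out => // -[_].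
      by rewrite mx_norm_ball /ball_/= sub0r normrN ltNge (ltW mx).
  have F0 : integral_diff alpha beta (F m) @[m --> \oo] --> 0.
    apply: (@integral_diff_cvg0 _ _ _ _ _ _ 2).
    - move=> m; apply: measurable_funB; first by case: bU.
      by case: (test_function_bounded_measurable (tV m)).
    - move=> m x; rewrite /F /= indicE.
      have := tent_ge0 (V m) (ler0n R m) x; have := tent_le1 (V m) (ler0n R m) x.
      by rewrite ler_norml; case: (_ \in _) => /=; lra.
    - move=> x; have [xU|xU] := boolP (x \in U); last first.
        rewrite (_ : (fun k => F k x) = cst 0); first exact: cvg_cst.
        apply/funext => m; rewrite /F /= indicE (negbTE xU) tent_out ?subrr//.
        by move=> [Ux _]; move/negP: xU; apply; rewrite inE.
      have /nbhs_ballP[r /= r0 rU] : nbhs x U.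
        by apply: open_nbhs_nbhs; split => //; rewrite -inE.
      apply/cvgrPdist_lt => e e0; near=> m.
      suff -> : F m x = 0 by rewrite subrr normr0.
      have xm : `|x| + r < m%:R by near: m; exact: nbhs_infty_gtr.
      rewrite /F /= indicE xU (@tent_in _ _ _ _ r) ?subrr//.
        by rewrite -ler_pdivrMr//; apply: ltW; near: m; exact: nbhs_infty_gtr.
      move=> y xy; split; first exact: rU.
      move: xy; rewrite mx_norm_ball /ball_/= => xy.
      rewrite sub0r normrN (le_lt_trans _ xm)// -[y](subrK x).
      by rewrite (le_trans (ler_normD _ _))// addrC lerD2l distrC ltW.
  have : integral_diff alpha beta \1_U = 0.
    have e : (fun m => integral_diff alpha beta (F m)) =
        (fun=> integral_diff alpha beta \1_U).
      apply/funext => m; rewrite /F integral_diffB//.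
        by rewrite (H _ (tV m)) subr0.
      exact: test_function_bounded_measurable.
    by move: F0; rewrite e => /cvg_lim <-//; rewrite lim_cst.
  rewrite /integral_diff /Rintegral !integral_indic// !setIT.
  move/eqP; rewrite subr_eq0 => /eqP ab.
  by rewrite -[LHS]fineK ?fin_num_measure// -[RHS]fineK ?fin_num_measure// ab.
- by move=> _; rewrite -ge0_fin_numE// fin_num_measure.
Unshelve. all: by end_near. Qed.

End test_functions.

(** * Irrational rotations and Cesaro means *)

Section kronecker.
Context {R : realType}.

(** Pigeonhole step: some positive multiple of [th] is close to a multiple
    of [L]. *)
Lemma multiple_near_period (L th e : R) : 0 < L -> 0 < e ->
  exists m : nat, exists n : int, (0 < m)%N /\ `|m%:R * th - n%:~R * L| < e.
Proof.
move=> L0 e0.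
(* the fractional part of [k * th / L] *)
pose fr (k : nat) := k%:R * th / L - (Num.floor (k%:R * th / L))%:~R.
have fr01 k : 0 <= fr k < 1.
  rewrite /fr subr_ge0 floor_le /= ltrBlDr addrC.
  by have := floorD1_gt (k%:R * th / L); rewrite intrD addrC.
have [N NP] : exists N : nat, L / e < N.+1%:R.
  exists (Num.truncn (L / e)).
  by have := truncn_itv (ltW (divr_gt0 L0 e0)) => /andP[].
have bnd k : (Num.truncn (N.+1%:R * fr k) < N.+1)%N.
  have /andP[f0 f1] := fr01 k.
  rewrite -(ltr_nat R); apply: (@le_lt_trans _ _ (N.+1%:R * fr k)).
    have : 0 <= N.+1%:R * fr k by rewrite mulr_ge0.
    by move/truncn_itv => /andP[].
  by rewrite gtr_pMr.
pose F (k : 'I_N.+2) : 'I_N.+1 := Ordinal (bnd k).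
have /injectivePn[i [j ij Fij]] : ~~ injectiveb F.
  apply/negP => /injectiveP/leq_card; rewrite !card_ord.
  by rewrite ltnn.
wlog lij : i j ij Fij / (i < j)%N.
  move=> W; have [|ji|/val_inj ije] := ltngtP i j; first exact: W.
    by apply: (W j i) => //; rewrite eq_sym.
  by rewrite ije eqxx in ij.
exists (j - i)%N, (Num.floor (j%:R * th / L) - Num.floor (i%:R * th / L)).
split; first by rewrite subn_gt0.
have -> : (j - i)%:R * th -
    (Num.floor (j%:R * th / L) - Num.floor (i%:R * th / L))%:~R * L =
    L * (fr j - fr i).
  rewrite /fr natrB ?(ltnW lij)// intrB; field; exact: lt0r_neq0.
rewrite normrM gtr0_norm// -ltr_pdivlMl//.
have /(congr1 val) /= tij := Fij.
have t01 k : (Num.truncn (N.+1%:R * fr k))%:R <= N.+1%:R * fr k <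
    (Num.truncn (N.+1%:R * fr k))%:R + 1.
  have /andP[f0 f1] := fr01 k.
  by rewrite natr1 truncn_itv// mulr_ge0.
have h : N.+1%:R * `|fr j - fr i| < 1.
  rewrite -[N.+1%:R]gtr0_norm// -normrM mulrBr ltr_norml.
  by have := t01 i; have := t01 j; rewrite tij; lra.
have N0 : 0 < N.+1%:R :> R by [].
have Ne : L < N.+1%:R * e by rewrite -ltr_pdivrMr.
rewrite -(ltr_pM2l N0) (lt_le_trans h)// (mulrC L^-1) mulrA.
by rewrite ler_pdivlMr// mul1r ltW.
Qed.

(** Kronecker's theorem in dimension one. *)
Lemma kronecker_dense (L th : R) : 0 < L ->
  (forall (m : nat) (n : int), (0 < m)%N -> m%:R * th <> n%:~R * L) ->
  forall t e, 0 < e ->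
  exists m : nat, exists n : int, `|m%:R * th - t - n%:~R * L| < e.
Proof.
move=> L0 irr t e e0.
have [m0 [n0 [m00]]] := multiple_near_period th L0 e0.
set dl := _ - _ => dle.
have dl0 : dl != 0 by apply/eqP => /eqP; rewrite subr_eq0 => /eqP; exact: irr.
(* a multiple of the period brings [t] on the same side of 0 as [dl] *)
have [l tl] : exists l : int, 0 <= (t + l%:~R * L) / dl.
  have tL : `|t| < (Num.truncn (`|t| / L)).+1%:R * L.
    by rewrite -ltr_pdivrMr// truncnS_gt.
  have [dp|dn] := ltP 0 dl.
    exists (Num.truncn (`|t| / L)).+1; rewrite divr_ge0// ?(ltW dp)//.
    by move: tL; rewrite -pmulrn; have := ler_norm (- t); rewrite normrN; lra.
  exists (- (Num.truncn (`|t| / L)).+1%:Z);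
    apply: mulr_le0; last by rewrite invr_le0.
  by move: tL; rewrite mulrNz -pmulrn; have := ler_norm t; lra.
pose y := (t + l%:~R * L) / dl; pose j := Num.truncn y.
exists (j * m0)%N, (j%:Z * n0 + l).
have -> : (j * m0)%:R * th - t - (j%:Z * n0 + l)%:~R * L = - (dl * (y - j%:R)).
  rewrite /y mulrBr mulrCA mulfV// mulr1 /dl natrM intrD intrM -pmulrn; ring.
rewrite normrN normrM (le_lt_trans _ dle)// ler_piMr//.
have /truncn_itv : 0 <= y by [].
by rewrite -natr1 -/j ler_norml => /andP[]; lra.
Qed.

End kronecker.

Section rotations.
Context {R : realType}.

Lemma periodicz (f : R -> R) (T : R) : periodic f T ->
  forall (n : int) a, f (a + T *~ n) = f a.
Proof.
move=> fT [n|n] a; first exact: periodicn.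
by rewrite NegzE mulrNz -(periodicn fT n.+1 (a - _)) -pmulrn subrK.
Qed.

Lemma polar_coordinates (X Y : R) :
  exists r psi : R, [/\ 0 <= r, X = r * cos psi & Y = r * sin psi].
Proof.
pose r := Num.sqrt (X ^+ 2 + Y ^+ 2).
have r2 : r ^+ 2 = X ^+ 2 + Y ^+ 2 by rewrite sqr_sqrtr// addr_ge0 ?sqr_ge0.
have [r0|r0] := eqVneq r 0.
  exists 0, 0; move: r2; rewrite r0 expr0n/= => /esym/eqP.
  rewrite paddr_eq0 ?sqr_ge0// !sqrf_eq0 => /andP[/eqP-> /eqP->].
  by rewrite !mul0r.
have rp : 0 < r by rewrite lt_neqAle eq_sym r0 sqrtr_ge0.
have Xr : -1 <= X / r <= 1.
  rewrite -ler_norml normrM normfV (gtr0_norm rp) ler_pdivrMr// mul1r.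
  rewrite -(@ler_pXn2r _ 2)// ?nnegrE ?(ltW rp)// r2 real_normK ?num_real//.
  by rewrite lerDl sqr_ge0.
have c : cos (acos (X / r)) = X / r by rewrite acosK// in_itv.
have s : sin (acos (X / r)) = `|Y| / r.
  rewrite sin_acos// -[RHS]ger0_norm ?divr_ge0 ?(ltW rp)// -sqrtr_sqr.
  congr Num.sqrt; rewrite !expr_div_n real_normK ?num_real// r2; field.
  by rewrite -r2 expf_eq0.
have [Y0|Y0] := leP 0 Y.
  exists r, (acos (X / r)); split; first exact: ltW.
    by rewrite c mulrCA mulfV ?mulr1.
  by rewrite s mulrCA mulfV ?mulr1// ger0_norm.
exists r, (- acos (X / r)); split; first exact: ltW.
  by rewrite cosN c mulrCA mulfV ?mulr1.
by rewrite sinN s mulrN mulrCA mulfV ?mulr1// ltr0_norm// opprK.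
Qed.

(** Kronecker's theorem, for rotations of a circle: the orbit of the point of
    angle [psi] comes close to the point of angle [- psi], uniformly along the
    two orbits. *)
Lemma rotation_orbit_near (th : R) :
  (forall (m : nat) (n : int), (0 < m)%N -> m%:R * th <> n%:~R * (pi *+ 2)) ->
  forall psi e, 0 < e -> exists m : nat, forall k : nat,
    `|cos (- psi + k%:R * th) - cos (psi + (k + m)%:R * th)| < e /\
    `|sin (- psi + k%:R * th) - sin (psi + (k + m)%:R * th)| < e.
Proof.
move=> irr psi e e0.
have [dl dl0 dlP] : exists2 dl : R, 0 < dl &
    forall x, `|x| < dl -> `|cos x - 1| < e / 2 /\ `|sin x| < e / 2.
  have e20 : 0 < e / 2 by rewrite divr_gt0.
  have : \forall x \near (0 : R), `|cos 0 - cos x| < e / 2.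
    by move/cvgrPdist_lt : (@continuous_cos R 0); apply.
  have : \forall x \near (0 : R), `|sin 0 - sin x| < e / 2.
    by move/cvgrPdist_lt : (@continuous_sin R 0); apply.
  move=> /nbhs_ballP[d1 /= d10 D1] /nbhs_ballP[d2 /= d20 D2].
  exists (Num.min d1 d2); first by rewrite lt_min d10.
  move=> x; rewrite lt_min => /andP[x1 x2]; split.
    by rewrite distrC -[X in `|X - _|]cos0; apply: D2; rewrite /ball/= sub0r normrN.
  by rewrite -normrN -sub0r -[X in `|X - _|]sin0; apply: D1;
    rewrite /ball/= sub0r normrN.
have L0 : 0 < pi *+ 2 :> R by rewrite mulrn_wgt0// pi_gt0.
have [m [n mn]] := kronecker_dense L0 irr (- (psi *+ 2)) dl0.
exists m => k; set x := _ - _ in mn.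
have [cx sx] := dlP _ mn.
pose A := - psi + k%:R * th.
have E : psi + (k + m)%:R * th = (A + x) + pi *+ 2 *~ n.
  by rewrite /A /x natrD -[in RHS]mulrzl; ring.
rewrite E (periodicz (@cosD2pi R)) (periodicz (@sinD2pi R)) -/A.
clearbody A; rewrite (cosD A x) (sinD A x).
have cA : `|cos A| <= 1 by rewrite ler_norml cos_geN1 cos_le1.
have sA : `|sin A| <= 1 by rewrite ler_norml sin_geN1 sin_le1.
split.
  have -> : cos A - (cos A * cos x - sin A * sin x) =
    - (cos A * (cos x - 1)) + sin A * sin x by ring.
  rewrite (le_lt_trans (ler_normD _ _))// normrN !normrM [e]splitr.
  by apply: ltrD; [apply: le_lt_trans cx|apply: le_lt_trans sx];
    rewrite ler_piMl.
have -> : sin A - (sin A * cos x + cos A * sin x) =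
  - (sin A * (cos x - 1)) - cos A * sin x by ring.
rewrite (le_lt_trans (ler_normB _ _))// normrN !normrM [e]splitr.
by apply: ltrD; [apply: le_lt_trans cx|apply: le_lt_trans sx]; rewrite ler_piMl.
Qed.

End rotations.

(** If [b] stays arbitrarily close to suitable shifts of [a], then the Cesaro
    means of [a - b] tend to 0. *)
Lemma cesaro_shadow {R : realType} (a b : nat -> R) :
  (forall k, `|a k| <= 1) ->
  (forall e, 0 < e -> exists m : nat, forall k, `|b k - a (k + m)%N| <= e) ->
  (n.+1%:R^-1 * \sum_(k < n.+1) (a k - b k)) @[n --> \oo] --> 0.
Proof.
move=> a1 ab; apply/cvgrPdist_lt => e e0.
have e20 : 0 < e / 2 by rewrite divr_gt0.
have [m mP] := ab _ e20.
have S n : `|\sum_(k < n) (a k - a (k + m)%N)| <= (m *+ 2)%:R.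
  (* the sum telescopes, up to [m] terms at each end *)
  have -> : \sum_(k < n) (a k - a (k + m)%N) =
      \sum_(k < m) (a k - a (k + n)%N).
    rewrite !sumrB; apply/eqP; rewrite -subr_eq0; apply/eqP.
    have A i j : \sum_(k < i + j) a k =
        \sum_(k < i) a k + \sum_(k < j) a (k + i)%N.
      by rewrite big_split_ord/=; congr (_ + _);
        apply: eq_bigr => k _; rewrite addnC.
    by have := A n m; rewrite addnC A; lra.
  rewrite (le_trans (ler_norm_sum _ _ _))//.
  rewrite (le_trans (ler_sum _ (G := fun=> 2) _))//.
    move=> k _; rewrite (le_trans (ler_normB _ _))//.
    by have := a1 k; have := a1 (k + n)%N; lra.
  by rewrite sumr_const card_ord mulr2n natrD -mulr_natl; lra.
near=> n; rewrite sub0r normrN normrM ger0_norm ?invr_ge0//.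
have n0 : 0 < n.+1%:R :> R by [].
rewrite mulrC ltr_pdivrMr//.
have -> : \sum_(k < n.+1) (a k - b k) = \sum_(k < n.+1) (a k - a (k + m)%N) -
    \sum_(k < n.+1) (b k - a (k + m)%N).
  by rewrite -sumrB; apply: eq_bigr => k _; ring.
have S2 : `|\sum_(k < n.+1) (b k - a (k + m)%N)| <= e / 2 * n.+1%:R.
  rewrite (le_trans (ler_norm_sum _ _ _))//.
  rewrite (le_trans (ler_sum _ (G := fun=> e / 2) _))//.
  by rewrite sumr_const card_ord mulr_natr.
rewrite (le_lt_trans (ler_normB _ _))//.
have : (m *+ 2)%:R < n.+1%:R * (e / 2).
  rewrite -ltr_pdivrMr//; near: n.
  exists (Num.truncn ((m *+ 2)%:R / (e / 2) : R)) => // i /= hi.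
  by rewrite (lt_le_trans (truncnS_gt _))// ler_nat ltnS.
by have := S n.+1; lra.
Unshelve. all: by end_near. Qed.

(** * Signed measures reversed by two affine reflections *)

Section row_vectors.
Context {R : realType} {d : nat}.
Implicit Types (x y u w : 'rV[R]_d) (f : 'rV[R]_d -> R).

Lemma dotpDl x y w : dotp (x + y) w = dotp x w + dotp y w.
Proof. by rewrite /dotp -big_split; apply: eq_bigr => i _; rewrite mxE mulrDl. Qed.

Lemma ler_coord_norm x i : `|x 0 i| <= `|x|.
Proof.
rewrite [leRHS]/Num.norm/= mx_normrE.
exact: (le_bigmax _ (fun ij : 'I_1 * 'I_d => `|x ij.1 ij.2|) (0, i)).
Qed.

Lemma ler_dotp_norm x w : `|dotp x w| <= `|x| * \sum_(i < d) `|w 0 i|.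
Proof.
rewrite mulr_sumr (le_trans (ler_norm_sum _ _ _))// ler_sum// => i _.
by rewrite normrM ler_wpM2r// ler_coord_norm.
Qed.

(** Test functions tend to 0 along a sequence on which the absolute value of
    some affine function tends to infinity. *)
Lemma test_function_escape f w e (s : nat -> 'rV[R]_d) : test_function f ->
  (forall M, \forall k \near \oo, M < `|dotp (s k) w + e|) ->
  f (s k) @[k --> \oo] --> (0 : R).
Proof.
move=> [_ _ [M fM]] se; apply/cvgrPdist_lt => eps eps0.
near=> k; suff -> : f (s k) = 0 by rewrite subrr normr0.
apply: fM; rewrite ltNge; apply/negP => skM.
have : `|M| * \sum_(i < d) `|w 0 i| + `|e| < `|dotp (s k) w + e|.
  by near: k; exact: se.
apply/negP; rewrite -leNgt (le_trans (ler_normD _ _))// lerD2r.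
rewrite (le_trans (ler_dotp_norm _ _))// ler_wpM2r ?sumr_ge0//.
by rewrite (le_trans skM)// ler_norm.
Unshelve. all: by end_near. Qed.

End row_vectors.

(** The affine reflection along the direction [u] whose mirror is the
    hyperplane of the zeros of [x |-> dotp x w + e]; it is an involution when
    [dotp u w = 2]. *)
Definition refl {R : realType} {d : nat} (u w : 'rV[R]_d) (e : R) x : 'rV[R]_d :=
  x - (dotp x w + e) *: u.

Lemma continuous_refl {R : realType} {d : nat} (u w : 'rV[R]_d) (e : R) :
  continuous (refl u w e).
Proof.
move=> x; have cw : continuous (fun y => dotp y w + e).
  by move=> y; exact: (cvgD (@continuous_dotp R d w y) (cvg_cst e)).
exact: (cvgB cvg_id (cvgZr_tmp (cw x))).
Qed.

Section two_reflections.
Context {R : realType} {d : nat}.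
Variables (u1 u2 w1 w2 : 'rV[R]_d) (e1 e2 : R).
Hypotheses (u1w1 : dotp u1 w1 = 2) (u2w2 : dotp u2 w2 = 2).
Implicit Types (x y : 'rV[R]_d) (f : 'rV[R]_d -> R).

(* [p] and [q] vanish on the mirrors of [T1] and [T2]; [T1], [T2] and [G] act
   linearly on the pair [(p, q)] *)
Let a := dotp u2 w1.
Let b := dotp u1 w2.
Let T1 := refl u1 w1 e1.
Let T2 := refl u2 w2 e2.
Let G := T2 \o T1.
Let p x := dotp x w1 + e1.
Let q x := dotp x w2 + e2.

Let pT1 x : p (T1 x) = - p x.
Proof. by rewrite /p /T1 /refl dotpBl dotpZl u1w1; ring. Qed.

Let qT1 x : q (T1 x) = q x - b * p x.
Proof. by rewrite /p /q /T1 /refl dotpBl dotpZl -/b; ring. Qed.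

Let pT2 x : p (T2 x) = p x - a * q x.
Proof. by rewrite /p /q /T2 /refl dotpBl dotpZl -/a; ring. Qed.

Let qT2 x : q (T2 x) = - q x.
Proof. by rewrite /q /T2 /refl dotpBl dotpZl u2w2; ring. Qed.

Let pG x : p (G x) = (a * b - 1) * p x - a * q x.
Proof. by rewrite /G /= pT2 pT1 qT1; ring. Qed.

Let qG x : q (G x) = b * p x - q x.
Proof. by rewrite /G /= qT2 qT1; ring. Qed.

Let mT1 : measurable_fun setT T1.
Proof. by apply: continuous_measurable_rV; exact: continuous_refl. Qed.

Let mT2 : measurable_fun setT T2.
Proof. by apply: continuous_measurable_rV; exact: continuous_refl. Qed.

Let mG : measurable_fun setT G.
Proof. exact: measurableT_comp. Qed.

Let mGk k : measurable_fun setT (iter k G).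
Proof.
elim: k => [|k IH]; first exact: measurable_id.
rewrite (_ : iter k.+1 G = G \o iter k G)//; exact: measurableT_comp.
Qed.

Section measures.
Variables alpha beta : {finite_measure set 'rV[R]_d -> \bar R}.
Hypothesis anti1 : forall A, measurable A ->
  (alpha A + alpha (T1 @^-1` A) = beta A + beta (T1 @^-1` A))%E.
Hypothesis anti2 : forall A, measurable A ->
  (alpha A + alpha (T2 @^-1` A) = beta A + beta (T2 @^-1` A))%E.

Let I := integral_diff alpha beta.

Let I_T1 f : bounded_measurable f -> I (f \o T1) = - I f.
Proof. exact: integral_diff_anti. Qed.

Let I_G f : bounded_measurable f -> I (f \o G) = I f.
Proof.
move=> bf; have bf2 := bounded_measurable_comp mT2 bf.
transitivity (I ((f \o T2) \o T1)); first by [].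
by rewrite I_T1// /I integral_diff_anti// opprK.
Qed.

Let I_Gk f k : bounded_measurable f -> I (f \o iter k G) = I f.
Proof.
move=> bf; elim: k => [//|k IH].
transitivity (I ((f \o iter k G) \o G)).
  by congr I; apply/funext => x /=; rewrite -iterSr.
by rewrite I_G//; exact: bounded_measurable_comp.
Qed.

(** If [f - f \o T1] tends to 0 along every orbit of [G], then [f] has
    integral 0. *)
Lemma integral_diff_wandering f : test_function f ->
  (forall x, f (iter k G x) - f (T1 (iter k G x)) @[k --> \oo] --> 0) ->
  I f = 0.
Proof.
move=> tf f0; have bf := test_function_bounded_measurable tf.
have bg := bounded_measurableB bf (bounded_measurable_comp mT1 bf).
have E k : I ((f \- (f \o T1)) \o iter k G) = I f *+ 2.
  rewrite I_Gk//; transitivity (I f - I (f \o T1)).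
    by apply: integral_diffB => //; exact: bounded_measurable_comp.
  by rewrite I_T1// opprK mulr2n.
have : I ((f \- (f \o T1)) \o iter k G) @[k --> \oo] --> 0.
  apply: (@integral_diff_cvg0 _ _ _ _ _ _ 1) => //.
  - by move=> k; case: (bounded_measurable_comp (mGk k) bg).
  - move=> k x /=; have [_ f01 _] := tf.
    by have := f01 (iter k G x); have := f01 (T1 (iter k G x));
      rewrite ler_norml; lra.
under eq_fun do rewrite E.
move=> /cvg_lim; rewrite lim_cst// => /(_ (@Rhausdorff R)) /eqP.
by rewrite mulrn_eq0 => /eqP.
Qed.

(** If the orbit of each [x] under [G], suitably shifted, follows the orbit of
    [T1 x], then [f] has asymptotically the same averages along both orbits, and
    its integral is 0. *)
Lemma integral_diff_shadow f : test_function f ->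
  (forall x e, 0 < e -> exists m : nat, forall k,
    `|f (iter k G (T1 x)) - f (iter (k + m) G x)| <= e) ->
  I f = 0.
Proof.
move=> tf sh; have bf := test_function_bounded_measurable tf.
pose D k := (f \o iter k G) \- ((f \o iter k G) \o T1).
have bfk k : bounded_measurable (f \o iter k G).
  by apply: bounded_measurable_comp; [exact: mGk|exact: bf].
have bfkT k : bounded_measurable ((f \o iter k G) \o T1).
  by apply: bounded_measurable_comp; [exact: mT1|exact: bfk].
have bD k : bounded_measurable (D k) by exact: bounded_measurableB.
have ID k : I (D k) = I f *+ 2.
  transitivity (I (f \o iter k G) - I ((f \o iter k G) \o T1)).
    exact: integral_diffB.
  by rewrite I_T1; [rewrite opprK I_Gk// mulr2n|exact: bfk].
pose S n x := \sum_(k < n.+1) D k x.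
have bS n : bounded_measurable (S n) by exact: bounded_measurable_sum.
pose F n x := n.+1%:R^-1 * S n x.
have IF n : I (F n) = I f *+ 2.
  transitivity (n.+1%:R^-1 * I (S n)); first exact: integral_diffZ.
  have -> : I (S n) = \sum_(k < n.+1) I (D k) by exact: integral_diff_sum.
  under eq_bigr do rewrite ID.
  by rewrite sumr_const card_ord -[X in _ * X]mulr_natl mulrA mulVf ?mul1r.
have : I (F n) @[n --> \oo] --> 0.
  apply: (@integral_diff_cvg0 _ _ _ _ _ _ 1).
  - by move=> n; case: (bounded_measurableZ n.+1%:R^-1 (bS n)).
  - move=> n x; rewrite /F normrM ger0_norm ?invr_ge0// mulrC ler_pdivrMr// mul1r.
    rewrite (le_trans (ler_norm_sum _ _ _))//.
    rewrite (le_trans (ler_sum _ (G := fun=> 1) _))//.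
      move=> k _; have [_ f01 _] := tf; rewrite /D /=.
      by have := f01 (iter k G x); have := f01 (iter k G (T1 x));
        rewrite ler_norml; lra.
    by rewrite sumr_const card_ord.
  - move=> x; have f1 k : `|f (iter k G x)| <= 1.
      by have [_ /(_ (iter k G x))/andP[? ?] _] := tf; rewrite ger0_norm.
    exact: (cesaro_shadow f1 (sh x)).
under eq_fun do rewrite IF.
move=> /cvg_lim; rewrite lim_cst// => /(_ (@Rhausdorff R)) /eqP.
by rewrite mulrn_eq0 => /eqP.
Qed.

End measures.

Let converges_to_mirror f x : test_function f ->
  p (iter k G x) @[k --> \oo] --> 0 ->
  f (iter k G x) - f (T1 (iter k G x)) @[k --> \oo] --> 0.
Proof.
move=> [[K fK] _ _] p0; apply/norm_cvg0P.
have h : (K * `|u1|) * `|p (iter k G x)| @[k --> \oo] --> 0.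
  by rewrite -[X in _ --> X](mulr0 (K * `|u1|)); apply: cvgMr; exact/norm_cvg0P.
apply: (squeeze_cvgr _ (cvg_cst 0) h).
near=> k; rewrite normr_ge0 /= (le_trans (fK _ _))// /T1 /refl -/(p (iter k G x)).
by rewrite opprB addrC subrK mx_normZ mulrA mulrAC.
Unshelve. all: by end_near. Qed.

Let wandering_escape f w e x : test_function f ->
  (forall M, \forall k \near \oo, M < `|dotp (iter k G x) w + e|) ->
  f (iter k G x) - f (T1 (iter k G x)) @[k --> \oo] --> 0.
Proof.
move=> tf se; rewrite -[X in _ --> X](subrr (0 : R)); apply: cvgB.
  exact: test_function_escape tf se.
apply: (test_function_escape (s := fun k => T1 (iter k G x))
  (w := w - dotp u1 w *: w1) (e := e - e1 * dotp u1 w) tf) => M.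
apply: filterS (se M) => k; congr (_ < `|_|).
rewrite /T1 /refl dotpBl dotpZl ![dotp _ (w - _)]dotpC !dotpBl !dotpZl.
by rewrite !(dotpC w) !(dotpC w1) u1w1; ring.
Qed.

(** Here the linear part of [G] on the plane of [u1] and [u2], which has
    determinant 1 and trace [a * b - 2], has two real eigenvalues [kp] and
    [kp^-1], with eigenfunctions [phi kp] and [phi kp^-1]. *)
Let wandering_hyperbolic f x : test_function f -> a * b < 0 \/ 4 < a * b ->
  f (iter k G x) - f (T1 (iter k G x)) @[k --> \oo] --> 0.
Proof.
move=> tf ab.
have [kp [k1 kE]] : exists kp : R, 1 < `|kp| /\ kp ^+ 2 - (a * b - 2) * kp + 1 = 0.
  have D0 : 0 <= a * b * (a * b - 4) by case: ab => ab; nra.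
  have sD := sqr_sqrtr D0; have sD0 := sqrtr_ge0 (a * b * (a * b - 4)).
  move: sD sD0; set D := Num.sqrt _ => sD sD0.
  case: ab => ab.
    exists ((a * b - 2 - D) / 2); split; last by nra.
    by rewrite ler0_norm; lra.
  exists ((a * b - 2 + D) / 2); split; last by nra.
  by rewrite ger0_norm; lra.
have kp0 : kp != 0 by apply: contraTneq k1 => ->; rewrite normr0 ltr10.
pose phi l x := (l + 1) * p x - a * q x.
have phiG l y : l ^+ 2 - (a * b - 2) * l + 1 = 0 -> phi l (G y) = l * phi l y.
  move=> E; rewrite /phi pG qG; apply/eqP; rewrite -subr_eq0; apply/eqP.
  by transitivity (- (l ^+ 2 - (a * b - 2) * l + 1) * p y); [ring|rewrite E; ring].
have phiGk l y k : l ^+ 2 - (a * b - 2) * l + 1 = 0 ->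
    phi l (iter k G y) = l ^+ k * phi l y.
  by move=> E; elim: k => [|k IH] /=; rewrite ?mul1r// phiG// IH exprS; ring.
have kVE : kp^-1 ^+ 2 - (a * b - 2) * kp^-1 + 1 = 0.
  transitivity (kp^-1 ^+ 2 * (kp ^+ 2 - (a * b - 2) * kp + 1));
    last by rewrite kE mulr0.
  by field.
have kV1 : `|kp^-1| < 1 by rewrite normfV invf_lt1// (lt_trans ltr01).
have [x0|x0] := eqVneq (phi kp x) 0.
  apply: converges_to_mirror => //.
  have kk : kp - kp^-1 != 0.
    rewrite subr_eq0; apply: contraTneq k1 => ->.
    by rewrite -leNgt ltW.
  have -> : (fun k => p (iter k G x)) =
      (fun k => kp^-1 ^+ k * (- (phi kp^-1 x / (kp - kp^-1)))).
    apply/funext => k; have := phiGk _ x k kE; have := phiGk _ x k kVE.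
    rewrite x0 mulr0 /phi => h1 h2.
    rewrite mulrN mulrA -h1 -mulNr -[LHS](mulfK kk); congr (_ / _).
    by rewrite -[RHS]addr0 -h2; ring.
  rewrite -[X in _ --> X](mul0r (- (phi kp^-1 x / (kp - kp^-1)))).
  by apply: cvgMl; exact: cvg_expr.
apply: (wandering_escape (w := (kp + 1) *: w1 - a *: w2)
  (e := (kp + 1) * e1 - a * e2) tf) => M.
have E k : dotp (iter k G x) ((kp + 1) *: w1 - a *: w2) +
    ((kp + 1) * e1 - a * e2) = kp ^+ k * phi kp x.
  rewrite -phiGk// /phi /p /q dotpC dotpBl !dotpZl !(dotpC _ (iter k G x)); ring.
have h : (kp^-1) ^+ k * (M / phi kp x) @[k --> \oo] --> 0.
  rewrite -[X in _ --> X](mul0r (M / phi kp x)).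
  by apply: cvgMl; exact: cvg_expr.
move/cvgrPdist_lt : h => /(_ 1 ltr01); apply: filterS => k.
rewrite sub0r normrN E !normrM => h.
rewrite (le_lt_trans (ler_norm M))// -(mulr1 (_ * _)).
rewrite -ltr_pdivrMl ?mulr_gt0 ?normr_gt0 ?expf_neq0//.
by move: h; rewrite !normfV exprVn !normfV invfM; congr (_ < _); ring.
Qed.

(** Here the linear part of [G] on the plane of [u1] and [u2] is unipotent: the
    function [w] is invariant and [p] grows linearly along orbits, unless [w]
    vanishes, in which case [G] acts as a translation of vector [- p x *: z]. *)
Let wandering_parabolic f x : test_function f -> a * b = 4 ->
  (forall c, u1 <> c *: u2) ->
  f (iter k G x) - f (T1 (iter k G x)) @[k --> \oo] --> 0.
Proof.
move=> tf ab indep.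
have a0 : a != 0 by apply/eqP => a0; move: ab; rewrite a0; lra.
have bE : b = 4 / a by rewrite -ab mulrC mulKf.
pose w y := 2 * p y - a * q y.
have wG y : w (G y) = w y.
  by rewrite /w pG qG ab bE; field.
have wGk k : w (iter k G x) = w x by elim: k => //= k IH; rewrite wG.
have pGk k : p (iter k G x) = p x + k%:R * w x.
  elim: k => [|k IH] /=; first by rewrite mul0r addr0.
  transitivity (p (iter k G x) + w (iter k G x)).
    by rewrite pG /w ab; ring.
  by rewrite IH wGk -natr1; ring.
have natM (c : R) (M : R) : c != 0 -> forall e,
    \forall k \near \oo, M < `|e + k%:R * c|.
  move=> c0 e; near=> k.
  have : (M + `|e|) / `|c| < k%:R by near: k; exact: nbhs_infty_gtr.
  rewrite ltr_pdivrMr ?normr_gt0// => h.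
  have : `|k%:R * c| <= `|e + k%:R * c| + `|e|.
    by rewrite -{1}[k%:R * c](addKr e) addrC (le_trans (ler_normB _ _)).
  by rewrite normrM normr_nat; lra.
have [w0|w0] := eqVneq (w x) 0; last first.
  apply: (wandering_escape (w := w1) (e := e1) tf) => M.
  have := natM _ M w0 (p x); apply: filterS => k.
  by rewrite -pGk.
have [p0|p0] := eqVneq (p x) 0.
  apply: converges_to_mirror => //.
  rewrite (_ : (fun k => _) = cst 0); first exact: cvg_cst.
  by apply/funext => k; rewrite pGk w0 p0 mulr0 addr0.
pose z := u1 - (2 / a) *: u2.
have [i zi] : exists i, z 0 i != 0.
  apply: contrapT => h; apply: (indep (2 / a)); apply/eqP; rewrite -subr_eq0.
  apply/eqP/rowP => i; rewrite !mxE; apply/eqP/negPn/negP => zi.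
  by apply: h; exists i; rewrite /z !mxE.
have Gz y : w y = 0 -> G y = y - p y *: z.
  move=> wy; have qy : q y = 2 / a * p y.
    by apply: (mulfI a0); rewrite mulrA mulrCA mulfV// mulr1;
      move: wy; rewrite /w; lra.
  rewrite /G /= {1}/T2 /refl -/(q (T1 y)) qT1 qy bE {1}/T1 /refl -/(p y) /z.
  by apply/rowP => j; rewrite !mxE; field.
have Gkz k : iter k G x = x - (k%:R * p x) *: z.
  elim: k => [|k IH] /=; first by rewrite mul0r scale0r subr0.
  rewrite Gz ?wGk// {1}IH pGk w0 mulr0 addr0 -addrA -opprD -scalerDl -natr1.
  by congr (_ - _ *: _); ring.
apply: (wandering_escape (w := delta_mx 0 i) (e := 0) tf) => M.
have pz : - (p x * z 0 i) != 0 by rewrite oppr_eq0 mulf_neq0.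
have := natM _ M pz (x 0 i); apply: filterS => k.
suff -> : dotp (iter k G x) (delta_mx 0 i) = x 0 i + k%:R * (- (p x * z 0 i)).
  by rewrite addr0.
rewrite /dotp (bigD1 i)//= big1 => [|j ji]; rewrite !mxE/=; last first.
  by rewrite (negbTE ji) mulr0.
by rewrite !eqxx mulr1 addr0 Gkz !mxE; ring.
Unshelve. all: by end_near. Qed.

(** Here [G] acts on the planes parallel to [u1] and [u2] as a rotation, up to a
    change of coordinates. *)
Let shadow_elliptic f : test_function f -> 0 < a * b < 4 ->
  (forall (m : nat) (n : int), (0 < m)%N ->
    m%:R * acos ((a * b - 2) / 2) <> n%:~R * (pi *+ 2)) ->
  forall x e, 0 < e -> exists m : nat, forall k,
    `|f (iter k G (T1 x)) - f (iter (k + m) G x)| <= e.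
Proof.
move=> [[K fK] _ _] /andP[ab0 ab4].
set th := acos _ => irr x e e0.
have a0 : a != 0 by apply: contraTneq ab0 => ->; rewrite mul0r ltxx.
have h1 : -1 <= (a * b - 2) / 2 <= 1 by lra.
have C : cos th = (a * b - 2) / 2 by rewrite acosK// in_itv.
have S0 : sin th != 0.
  by rewrite sin_acos// gt_eqF// sqrtr_gt0; nra.
have SC : sin th ^+ 2 = 1 - cos th ^+ 2 by rewrite -(cos2Dsin2 th); ring.
have b4 : b = (2 * cos th + 2) / a by rewrite C; field.
(* in the coordinates [X], [Y], the map [G] is the rotation of angle [th] and
   [T1] is the symmetry with respect to the first axis *)
pose X y := (cos th + 1) * p y - a * q y.
pose Y y := sin th * p y.
have XG y : X (G y) = cos th * X y - sin th * Y y.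
  rewrite /X /Y pG qG [sin th * (_ * _)]mulrA -expr2 SC b4; field; exact: a0.
have YG y : Y (G y) = sin th * X y + cos th * Y y.
  by rewrite /X /Y pG b4; field.
have XT y : X (T1 y) = X y by rewrite /X pT1 qT1 b4; field.
have YT y : Y (T1 y) = - Y y by rewrite /Y pT1; ring.
(* [O y] is the fixed point of [G] in the plane through [y] *)
pose s y := (2 * p y - a * q y) / (4 - a * b).
pose t y := (2 * q y - b * p y) / (4 - a * b).
pose O y := y - s y *: u1 - t y *: u2.
have ab40 : 4 - a * b != 0 by rewrite subr_eq0 gt_eqF.
have OT1 y : O (T1 y) = O y.
  by apply/rowP => i; rewrite /O /s /t pT1 qT1 !mxE -/(p y); field.
have OT2 y : O (T2 y) = O y.
  by apply/rowP => i; rewrite /O /s /t pT2 qT2 !mxE -/(q y); field.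
have OGk k y : O (iter k G y) = O y by elim: k => //= k IH; rewrite OT2 OT1.
pose z1 := (4 - a * b)^-1 *: (u1 - (2 / a) *: u2).
pose z2 := ((1 - cos th) / (sin th * (4 - a * b))) *: u1 +
  ((2 * (cos th + 1) / a - b) / (sin th * (4 - a * b))) *: u2.
have yE y : y = O y + X y *: z1 + Y y *: z2.
  by apply/rowP => i; rewrite /O /z1 /z2 /X /Y /s /t !mxE; field; rewrite ab40 S0 a0.
clearbody z1 z2.
have [r [psi [r0 Xr Yr]]] := polar_coordinates (X x) (Y x).
have rot y c : X y = r * cos c -> Y y = r * sin c -> forall k,
    X (iter k G y) = r * cos (c + k%:R * th) /\
    Y (iter k G y) = r * sin (c + k%:R * th).
  move=> Xy Yy; elim=> [|k [IX IY]]; first by rewrite mul0r addr0.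
  have -> : c + k.+1%:R * th = (c + k%:R * th) + th by rewrite -natr1; ring.
  by rewrite iterS XG YG IX IY (cosD _ th) (sinD _ th); split; ring.
have M0 : 0 < `|K| * (r * (`|z1| + `|z2|)) + 1.
  by rewrite ltr_wpDl// !mulr_ge0 ?addr_ge0.
have [m mP] := rotation_orbit_near irr psi (divr_gt0 e0 M0).
exists m => k; have [Hc Hs] := mP k.
have [||X1 Y1] := rot (T1 x) (- psi) _ _ k; first by rewrite XT cosN.
  by rewrite YT sinN Yr mulrN.
have [X2 Y2] := rot x psi Xr Yr (k + m)%N.
rewrite (le_trans (fK _ _))//.
have -> : iter k G (T1 x) - iter (k + m) G x =
    (r * (cos (- psi + k%:R * th) - cos (psi + (k + m)%:R * th))) *: z1 +
    (r * (sin (- psi + k%:R * th) - sin (psi + (k + m)%:R * th))) *: z2.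
  rewrite [in LHS](yE (iter k G (T1 x))) [in LHS](yE (iter (k + m) G x)).
  rewrite !OGk OT1 X1 Y1 X2 Y2; apply/rowP => i; rewrite !mxE; ring.
set dc := _ - _ in Hc *; set ds := _ - _ in Hs *.
set eta := e / _ in Hc Hs.
have eta0 : 0 <= eta by rewrite divr_ge0 ?ltW.
have h : `|(r * dc) *: z1 + (r * ds) *: z2| <= eta * (r * (`|z1| + `|z2|)).
  rewrite (le_trans (ler_normD _ _))// !mx_normZ !normrM (ger0_norm r0).
  have -> : eta * (r * (`|z1| + `|z2|)) =
    r * eta * `|z1| + r * eta * `|z2| by ring.
  by rewrite lerD// ler_wpM2r// ler_wpM2l// ltW.
rewrite (le_trans (ler_wpM2r (normr_ge0 _) (ler_norm K)))//.
rewrite (le_trans (ler_wpM2l (normr_ge0 K) h))// mulrCA /eta.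
by rewrite mulrAC ler_pdivrMr// ler_wpM2l ?(ltW e0)// lerDl.
Qed.

(** Two finite measures whose difference is reversed by both reflections are
    equal, unless the trace [a * b - 2] of the product of the reflections on the
    plane of [u1] and [u2] is [2 * cos th] for a rational multiple [th] of
    [2 * pi] with [cos th <> 1]. *)
Lemma eq_measure_two_reflections
    (alpha beta : {finite_measure set 'rV[R]_d -> \bar R}) :
  (forall A, measurable A ->
    (alpha A + alpha (T1 @^-1` A) = beta A + beta (T1 @^-1` A))%E) ->
  (forall A, measurable A ->
    (alpha A + alpha (T2 @^-1` A) = beta A + beta (T2 @^-1` A))%E) ->
  (forall c, u1 <> c *: u2) ->
  (forall c : rat, let th := ratr c * (pi *+ 2) in
    cos th <> 1 -> a * b <> 2 + 2 * cos th) ->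
  forall A, measurable A -> alpha A = beta A.
Proof.
move=> anti1 anti2 indep rot; apply: eq_measure_test_function => f tf.
have ab0 : a * b != 0.
  apply/eqP => ab0; have E : ratr (1 / 2) * (pi *+ 2) = pi :> R.
    by rewrite fmorph_div rmorph1 rmorph_nat -mulr_natr; field.
  (* the reflections commute and their product is a half-turn *)
  by apply: (rot (1 / 2)); rewrite /= E cospi ?ab0; lra.
have [ab|ab|ab] := ltgtP (a * b) 4; last 1 first.
- by apply: integral_diff_wandering => // x; exact: wandering_parabolic.
- have [ab1|ab1] := ltP (a * b) 0.
    by apply: integral_diff_wandering => // x;
      apply: wandering_hyperbolic => //; left.
  have {}ab1 : 0 < a * b by rewrite lt_neqAle eq_sym ab0.
  apply: integral_diff_shadow => //; apply: shadow_elliptic => //.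
    by rewrite ab1.
  move=> m n m0 E.
  have m0' : m%:R != 0 :> R by rewrite pnatr_eq0 -lt0n.
  have thE : acos ((a * b - 2) / 2) = ratr (n%:~R / m%:R) * (pi *+ 2) :> R.
    rewrite fmorph_div rmorph_int rmorph_nat -[LHS](mulKf m0') E; field; exact: m0'.
  have cE : cos (acos ((a * b - 2) / 2)) = (a * b - 2) / 2.
    by rewrite acosK// in_itv/=; lra.
  by apply: (rot (n%:~R / m%:R)); rewrite -thE cE; lra.
- by apply: integral_diff_wandering => // x;
    apply: wandering_hyperbolic => //; right.
Qed.

End two_reflections.

(** * The exceptional pairs of directions form a null set *)

Section null_sets.
Context {R : realType}.

Lemma finite_poly_roots (p : {poly R}) : p != 0 -> finite_set [set t | p.[t] = 0].
Proof.
move=> p0; apply: contrapT => /(@infinite_set_fset _ _ (size p)) [B Bp].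
apply/negP; rewrite -ltnNge; apply: max_poly_roots => //.
  by apply/allP => t tB; apply/rootP; exact: Bp.
exact: finmap.fset_uniq.
Qed.

(** A measurable function that is polynomial along each line vanishes on a null
    set only, unless it is identically zero. *)
Lemma lebesgue_rV_zeros n (f : 'rV[R]_n -> R) : measurable_fun setT f ->
  (forall a b, exists p : {poly R}, forall t, f (a + t *: b) = p.[t]) ->
  forall x0, f x0 <> 0 -> lebesgue_rV n (f @^-1` [set 0]) = 0%E.
Proof.
elim: n f => [|n IH] f mf fp x0 fx0.
  rewrite /= diracE memNset//= => f0; apply: fx0; rewrite -f0; congr f.
  by apply/rowP => -[].
set Z := f @^-1` [set 0].
have mZ : measurable (@cons_rV R n @^-1` Z).
  rewrite -[X in measurable X]setTI; apply: measurable_cons_rV => //.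
  by rewrite -[X in measurable X]setTI; apply: mf.
rewrite /= /lebesgue_step /pushforward /product_measure1.
pose t0 := (uncons_rV x0).1; pose y0 := (uncons_rV x0).2.
have x0E : cons_rV (t0, y0) = x0.
  apply/rowP => i; case: (unliftP ord0 i) => [j ->|->].
    by rewrite cons_rVS /= mxE.
  by rewrite cons_rV0.
have consE t y : cons_rV (t, y) =
    cons_rV (0, y) + t *: cons_rV (1 : R, 0 : 'rV[R]_n).
  apply/rowP => i; rewrite [RHS]mxE [X in _ + X]mxE.
  case: (unliftP ord0 i) => [j ->|->].
    by rewrite !cons_rVS /= mxE mulr0 addr0.
  by rewrite !cons_rV0 /= add0r mulr1.
(* the section at [t] is null unless [f] vanishes at [(t, y0)], which excludes
   finitely many [t] only *)
have [p pE] := fp (cons_rV (0, y0)) (cons_rV (1, 0)).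
have p0 : p != 0.
  apply/eqP => p0; apply: fx0; rewrite -x0E consE pE p0; exact: horner0.
have finZ := finite_poly_roots p0.
rewrite -[RHS](@integral0 _ _ _ (@lebesgue_measure R) setT).
apply: ge0_ae_eq_integral => //.
  exact: (measurable_fun_xsection (lebesgue_rV n) mZ).
exists [set t | p.[t] = 0]; split.
- by apply: countable_measurable (finite_set_countable finZ) => t;
    exact: measurable_set1.
- exact: (countable_lebesgue_measure0 (finite_set_countable finZ)).
- move=> t /=; apply: contra_notP => pt _ /=.
  have -> : xsection (@cons_rV R n @^-1` Z) t =
      (fun y => f (cons_rV (t, y))) @^-1` [set 0].
    by apply/seteqP; split => y; rewrite /xsection/= inE.
  apply: (IH _ _ _ y0).
  + apply: measurableT_comp => //.
    by apply: measurableT_comp; [exact: measurable_cons_rV|exact: pair1_measurable].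
  + move=> y b; have [r rE] := fp (cons_rV (t, y)) (cons_rV (0, b)).
    exists r => s; rewrite -rE; congr f.
    apply/rowP => i; rewrite [RHS]mxE [X in _ = _ + X]mxE.
    case: (unliftP ord0 i) => [j ->|->]; first by rewrite !cons_rVS /= !mxE.
    by rewrite !cons_rV0 /= mulr0 addr0.
  + by rewrite consE pE.
Qed.

End null_sets.

Section exceptional_set.
Context {R : realType} {d : nat}.
Variable A : 'M[R]_d.
Hypothesis symA : A^T = A.
Implicit Types x y u : 'rV[R]_d.

(** The bilinear form of matrix [A]. *)
Definition bform x y : R := dotp (x *m A) y.

Lemma bformC x y : bform x y = bform y x.
Proof.
have E z w : dotp z w = (z *m w^T) 0 0.
  by rewrite mxE; apply: eq_bigr => i _; rewrite mxE.
rewrite /bform !E; transitivity ((x *m A *m y^T)^T 0 0); first by rewrite [RHS]mxE.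
by rewrite !trmx_mul trmxK symA mulmxA.
Qed.

Lemma bformE x : (x *m A *m x^T) 0 0 = bform x x.
Proof.
by rewrite mxE; apply: eq_bigr => i _; rewrite [x^T _ _]mxE.
Qed.

Lemma bformDl x y z : bform (x + y) z = bform x z + bform y z.
Proof. by rewrite /bform mulmxDl dotpDl. Qed.

Lemma bformZl (c : R) x y : bform (c *: x) y = c * bform x y.
Proof. by rewrite /bform -scalemxAl dotpZl. Qed.

Lemma bformDr x y z : bform x (y + z) = bform x y + bform x z.
Proof. by rewrite bformC bformDl !(bformC _ x). Qed.

Lemma bformZr (c : R) x y : bform x (c *: y) = c * bform x y.
Proof. by rewrite bformC bformZl (bformC _ x). Qed.

Lemma measurable_bform dT (T : measurableType dT) (g h : T -> 'rV[R]_d) :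
  measurable_fun setT g -> measurable_fun setT h ->
  measurable_fun setT (fun t => bform (g t) (h t)).
Proof.
move=> mg mh.
have mc (i : 'I_d) : measurable_fun setT (fun x : 'rV[R]_d => x 0 i).
  by apply: continuous_measurable_real => x; exact: coord_continuous.
rewrite /bform /dotp; apply: measurable_sum => i; apply: measurable_funM.
  under eq_fun do rewrite mxE.
  apply: measurable_sum => j; apply: measurable_funM => //.
  exact: (measurableT_comp (mc j) mg).
exact: (measurableT_comp (mc i) mh).
Qed.

(** If moreover [Q(u2) != 0], this says that the trace
    [4 B(u1,u2)^2 / (Q(u1) Q(u2)) - 2] is equal to [2 * cos th]; the equation is
    multiplied by [Q(u1) Q(u2)] so that it is homogeneous in [u2]. *)
Definition finite_order_pairs (th : R) : set ('rV[R]_d * 'rV[R]_d) :=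
  [set u | bform u.1 u.1 != 0 /\
    4 * bform u.1 u.2 ^+ 2 = (2 + 2 * cos th) * bform u.1 u.1 * bform u.2 u.2].

Lemma finite_order_pairs_null th : cos th <> 1 ->
  (surface_measure d \x surface_measure d)%E.-negligible (finite_order_pairs th).
Proof.
move=> cth.
pose h (u : 'rV[R]_d * 'rV[R]_d) := 4 * bform u.1 u.2 ^+ 2 -
  (2 + 2 * cos th) * bform u.1 u.1 * bform u.2 u.2.
have mh dT (T : measurableType dT) (g k : T -> 'rV[R]_d) :
    measurable_fun setT g -> measurable_fun setT k ->
    measurable_fun setT (fun t => h (g t, k t)).
  move=> mg mk; apply: measurable_funB; apply: measurable_funM => //.
  - by apply: measurable_funX; exact: measurable_bform.
  - by apply: measurable_funM => //; exact: measurable_bform.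
  - exact: measurable_bform.
have zeroE : finite_order_pairs th =
    ((fun u : 'rV[R]_d * 'rV[R]_d => bform u.1 u.1) @^-1` ~` [set 0]) `&`
    ((fun u : 'rV[R]_d * 'rV[R]_d => h (u.1, u.2)) @^-1` [set 0]).
  apply/seteqP; split => u [/= u1 hu].
    by split; [exact/eqP|rewrite /h /= hu subrr].
  by split; [exact/eqP|move: hu; rewrite /h /= => /eqP; rewrite subr_eq0 => /eqP].
have m1 : measurable_fun setT (@fst 'rV[R]_d 'rV[R]_d) by exact: measurable_fst.
have m2 : measurable_fun setT (@snd 'rV[R]_d 'rV[R]_d) by exact: measurable_snd.
have mN : measurable (finite_order_pairs th).
  rewrite zeroE; apply: measurableI; rewrite -[X in measurable X]setTI.
    by apply: (measurable_bform m1 m1) => //; exact: measurableC.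
  by apply: (mh _ _ _ _ m1 m2).
apply/negligibleP => //; apply: integral0_eq => u _ /=.
have [u0|u0] := eqVneq (bform u u) 0.
  rewrite (_ : xsection _ _ = set0)// -subset0 => w.
  by rewrite /xsection/= inE => -[/=]; rewrite u0 eqxx.
(* the section is a cone over zeros of the quadratic form [h (u, .)] *)
rewrite /surface_measure; set C := cone _.
suff -> : lebesgue_rV d C = 0%E by rewrite mule0.
pose g w := h (u, w).
have mg : measurable_fun setT g by apply: mh => //; exact: measurable_id.
have g0 : lebesgue_rV d (g @^-1` [set 0]) = 0%E.
  apply: (lebesgue_rV_zeros mg _ (x0 := u)).
    move=> a b; pose c := (2 + 2 * cos th) * bform u u.
    exists (4%:P * ((bform u a)%:P + (bform u b) *: 'X) ^+ 2 -
      c%:P * ((bform a a)%:P + (2 * bform a b) *: 'X + (bform b b) *: 'X^2)).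
    move=> t; rewrite !hornerE /g /h /= !(bformDr, bformDl, bformZl, bformZr).
    by rewrite (bformC b a) /c; ring.
  rewrite /g /h /= => /eqP.
  have -> : 4 * bform u u ^+ 2 - (2 + 2 * cos th) * bform u u * bform u u =
    2 * (1 - cos th) * bform u u ^+ 2 by ring.
  rewrite !mulf_eq0 ?(negbTE u0) !orbF pnatr_eq0/= subr_eq0 => /eqP/esym.
  exact: cth.
apply: (subset_measure0 _ _ _ g0).
- apply: measurable_cone.
  exact: measurable_xsection.
- by rewrite -[X in measurable X]setTI; apply: mg.
- move=> _ [r _ [w [+ _] <-]]; rewrite /xsection/= inE => -[_ /= hw].
  rewrite /g /h /= !(bformZl, bformZr).
  transitivity (r ^+ 2 * (4 * bform u w ^+ 2 -
    (2 + 2 * cos th) * bform u u * bform w w)).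
    by ring.
  by rewrite hw subrr mulr0.
Qed.

(** If moreover [Q(u2) != 0], this says that the product of the two reflections
    acts on the plane of [u1] and [u2] with the trace of a nontrivial rotation of
    finite order. *)
Definition exceptional_pairs : set ('rV[R]_d * 'rV[R]_d) :=
  \bigcup_(c in [set c : rat | cos (ratr c * (pi *+ 2) : R) <> 1])
    finite_order_pairs (ratr c * (pi *+ 2)).

Lemma exceptional_pairs_null :
  (surface_measure d \x surface_measure d)%E.-negligible exceptional_pairs.
Proof.
pose F (k : nat) := if unpickle k is Some c then
  if `[< cos (ratr (c : rat) * (pi *+ 2) : R) = 1 >] then set0
  else finite_order_pairs (ratr c * (pi *+ 2)) else set0.
apply: (@negligibleS _ _ _ _ (\bigcup_k F k)).
  move=> u [c c1 cu]; exists (pickle c); first exact: I.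
  by rewrite /F pickleK asboolF.
apply: negligible_bigcup => k; rewrite /F.
case: unpickle => [c|]; last exact: negligible_set0.
case: asboolP => c1; first exact: negligible_set0.
exact: finite_order_pairs_null.
Qed.

End exceptional_set.

(** * Charges on a quadric with the same projection *)

Section charges.
Context {dT : measure_display} {T : measurableType dT} {R : realType}.
Implicit Types (mu nu : {charge set T -> \bar R}) (A B S : set T).

Lemma supported_in_eq mu S A B : supported_in mu S ->
  measurable A -> measurable B -> A `&` S = B `&` S -> mu A = mu B.
Proof.
move=> muS mA mB AB.
have sub X Y : X `&` S = Y `&` S -> X `\` Y `<=` ~` S.
  move=> XY x [Xx Yx] Sx; apply: Yx.
  by have [] : (Y `&` S) x by rewrite -XY.
rewrite (chargeDI mu mA mB) (chargeDI mu mB mA).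
rewrite (muS _ (measurableD mA mB) (sub _ _ AB)).
by rewrite (muS _ (measurableD mB mA) (sub _ _ (esym AB))) setIC.
Qed.

Lemma charge_setUI mu A B : measurable A -> measurable B ->
  (mu (A `|` B) + mu (A `&` B) = mu A + mu B)%E.
Proof.
move=> mA mB.
rewrite (chargeDI mu (measurableU _ _ mA mB) mA) (chargeDI mu mB mA).
rewrite setDUl setDv set0U (setIidr (@subsetUl _ A B)) (setIC B A).
by rewrite -addeA addeCA.
Qed.

(** If two charges agree on the sets that are invariant under an involution
    [t], then [t] reverses their difference; for [A] in general, apply this to
    the union and the intersection of [A] and its preimage. *)
Lemma charge_invariant_anti mu nu (t : T -> T) :
  measurable_fun setT t -> (forall x, t (t x) = x) ->
  (forall C, measurable C -> t @^-1` C = C -> mu C = nu C) ->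
  forall A, measurable A ->
    (mu A + mu (t @^-1` A) = nu A + nu (t @^-1` A))%E.
Proof.
move=> mt tK eqC A mA.
have mtA : measurable (t @^-1` A) by rewrite -[X in measurable X]setTI; exact: mt.
have tt : t @^-1` (t @^-1` A) = A by apply/seteqP; split => x /=; rewrite tK.
rewrite -(charge_setUI mu mA mtA) -(charge_setUI nu mA mtA).
congr (_ + _)%E; apply: eqC.
- exact: measurableU.
- by rewrite preimage_setU tt setUC.
- exact: measurableI.
- by rewrite preimage_setI tt setIC.
Qed.

(** The difference of two charges is a difference of finite measures; the
    equation is stated without subtraction. *)
Lemma charge_diff_measures mu nu :
  exists alpha beta : {finite_measure set T -> \bar R},
    forall A, measurable A -> (mu A + beta A = nu A + alpha A)%E.
Proof.
pose la : {charge set T -> \bar R} := cadd mu (copp nu).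
have [P [N PN]] := Hahn_decomposition la.
pose al : {finite_measure set T -> \bar R} := jordan_pos PN.
pose be : {finite_measure set T -> \bar R} := jordan_neg PN.
exists al, be => A mA.
have : (mu A - nu A = al A - be A)%E.
  by transitivity (la A); rewrite // (jordan_decomp PN mA) /cadd/= cscaleN1.
have fa : al A \is a fin_num by exact: fin_num_measure.
have fb : be A \is a fin_num by exact: fin_num_measure.
have fm : mu A \is a fin_num by exact: fin_num_measure.
have fn : nu A \is a fin_num by exact: fin_num_measure.
rewrite -(fineK fm) -(fineK fn) -(fineK fa) -(fineK fb).
by rewrite -!EFinN -!EFinD => -[] h; congr EFin; lra.
Qed.

Lemma charge_diff_anti mu nu (alpha beta : {finite_measure set T -> \bar R})
    A B : measurable A -> measurable B ->
  (forall C, measurable C -> mu C + beta C = nu C + alpha C)%E ->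
  (mu A + mu B = nu A + nu B)%E -> (alpha A + alpha B = beta A + beta B)%E.
Proof.
move=> mA mB E; have := E _ mB; have := E _ mA.
have fin (m : {charge set T -> \bar R}) C : measurable C -> m C \is a fin_num.
  by move=> mC; exact: fin_num_measure.
have fin' (m : {finite_measure set T -> \bar R}) C :
    measurable C -> m C \is a fin_num.
  by move=> mC; exact: fin_num_measure.
rewrite -(fineK (fin mu _ mA)) -(fineK (fin mu _ mB)).
rewrite -(fineK (fin nu _ mA)) -(fineK (fin nu _ mB)).
rewrite -(fineK (fin' alpha _ mA)) -(fineK (fin' alpha _ mB)).
rewrite -(fineK (fin' beta _ mA)) -(fineK (fin' beta _ mB)).
by rewrite -!EFinD => -[h1] [h2] [h3]; congr EFin; lra.
Qed.

End charges.

Lemma continuous_bform_diag {R : realType} {d : nat} (A : 'M[R]_d) :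
  continuous (fun x => bform A x x).
Proof.
have cc i : continuous (fun x : 'rV[R]_d => x 0 i).
  by move=> x; exact: coord_continuous.
rewrite /bform /dotp; apply: continuous_sum => i x; apply: (cvgM _ (cc i x)).
suff c : continuous (fun x : 'rV[R]_d => \sum_j x 0 j * A j i).
  by rewrite mxE; under eq_fun do rewrite mxE; exact: c.
by apply: continuous_sum => j y; exact: (cvgM (cc j y) (cvg_cst (A j i))).
Qed.

Section quadric.
Context {R : realType} {d : nat}.
Variable A : 'M[R]_d.
Hypothesis symA : A^T = A.
Variables (v : 'rV[R]_d) (rho : R).
Implicit Types x y u : 'rV[R]_d.

Let Q x := bform A x x.
Let S := quadric Q v rho.

(** Half of the derivative along [u] of the polynomial defining the quadric. *)
Let slope u x := bform A x u + dotp v u.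

(** The mirror of the reflection along [u] is the hyperplane where [slope u]
    vanishes; [2 * slope u x / Q u] is written as
    [dotp x (quadric_normal u) + quadric_offset u]. *)
Definition quadric_normal u : 'rV[R]_d := (2 / Q u) *: (u *m A).
Definition quadric_offset u : R := 2 * dotp v u / Q u.

(** The reflection along [u] that exchanges the two points of the quadric on
    each line of direction [u]. *)
Definition quadric_refl u := refl u (quadric_normal u) (quadric_offset u).

Lemma dotp_quadric_normal u y : dotp y (quadric_normal u) = 2 / Q u * bform A u y.
Proof. by rewrite dotpC dotpZl. Qed.

Let quadric_reflE u x : quadric_refl u x = x - (2 * slope u x / Q u) *: u.
Proof.
rewrite /quadric_refl /refl dotp_quadric_normal /quadric_offset /slope.
by congr (_ - _ *: _); rewrite (bformC symA); ring.
Qed.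

Let quadric_polyD u y (t : R) :
  Q (y + t *: u) + 2 * dotp v (y + t *: u) =
  Q y + 2 * dotp v y + 2 * t * slope u y + t ^+ 2 * Q u.
Proof.
rewrite /Q /slope !(bformDl, bformDr symA, bformZl, bformZr symA) (bformC symA u y).
rewrite (dotpC v (_ + _)) dotpDl dotpZl !(dotpC _ v); ring.
Qed.

Let slopeD u y (t : R) : slope u (y + t *: u) = slope u y + t * Q u.
Proof. by rewrite /slope bformDl bformZl /Q; ring. Qed.

(** The point of the quadric on the line [y + t *: u] where [slope u] is
    nonnegative, if the line meets the quadric. *)
Let section u y : 'rV[R]_d :=
  y + ((Num.sqrt (slope u y ^+ 2 - Q u * (Q y + 2 * dotp v y - rho)) - slope u y) /
       Q u) *: u.

Let section_proj u x : Q u <> 0 -> S x ->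
  section u (proj_hyperplane u x) = x \/
  section u (proj_hyperplane u x) = quadric_refl u x.
Proof.
move=> /eqP Qu Sx.
set y := proj_hyperplane u x; pose t := dotp x u.
have xE : x = y + t *: u by rewrite /y /proj_hyperplane subrK.
have sx : slope u x = slope u y + t * Q u by rewrite {1}xE slopeD.
have rhoE : rho = Q y + 2 * dotp v y + 2 * t * slope u y + t ^+ 2 * Q u.
  by rewrite -quadric_polyD -xE; exact/esym.
have D : slope u y ^+ 2 - Q u * (Q y + 2 * dotp v y - rho) = slope u x ^+ 2.
  by rewrite rhoE sx; ring.
rewrite /section D sqrtr_sqr.
have [s0|s0] := leP 0 (slope u x); [left|right].
  rewrite [RHS]xE; congr (_ + _ *: _).
  by rewrite ger0_norm// sx; field.
rewrite quadric_reflE [X in _ = X - _]xE -[RHS]addrA -scalerBl; congr (_ + _ *: _).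
by rewrite ltr0_norm// sx; field.
Qed.

Let continuous_slope u : continuous (slope u).
Proof.
move=> x; have c : continuous (fun y => dotp y (u *m A) + dotp v u).
  by move=> y; exact: (cvgD (@continuous_dotp R d _ y) (cvg_cst _)).
suff -> : slope u = (fun y => dotp y (u *m A) + dotp v u) by exact: c.
by apply/funext => y; rewrite /slope (bformC symA) /bform dotpC.
Qed.

Let continuous_section u : continuous (section u).
Proof.
have cp : continuous (fun y => Q y + 2 * dotp v y - rho).
  have cv : continuous (dotp v).
    by rewrite (_ : dotp v = (fun y => dotp y v));
      [exact: continuous_dotp|apply/funext => y; exact: dotpC].
  move=> y; have cQ := @continuous_bform_diag R d A y.
  have c2 : 2 * dotp v z @[z --> y] --> 2 * dotp v y.
    exact: (cvgM (cvg_cst (2 : R)) (cv y)).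
  exact: (cvgB (cvgD cQ c2) (cvg_cst rho)).
have cd : continuous (fun y => slope u y ^+ 2 - Q u * (Q y + 2 * dotp v y - rho)).
  move=> y; have cu := @continuous_slope u y.
  exact: (cvgB (cvgM cu cu) (cvgM (cvg_cst (Q u)) (cp y))).
have cs : continuous (fun y => Num.sqrt (slope u y ^+ 2 -
    Q u * (Q y + 2 * dotp v y - rho))).
  move=> y; exact: (continuous_comp (cd y) (@sqrt_continuous R _)).
pose s z := (Num.sqrt (slope u z ^+ 2 - Q u * (Q z + 2 * dotp v z - rho)) -
  slope u z) / Q u.
have ct y : s z @[z --> y] --> s y.
  exact: (cvgM (cvgB (cs y) (@continuous_slope u y)) (cvg_cst (Q u)^-1)).
move=> y; exact: (cvgD cvg_id (cvgZr_tmp (ct y))).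
Qed.

Let measurable_section u : measurable_fun setT (section u).
Proof. by apply: continuous_measurable_rV; exact: continuous_section. Qed.

(** If the projections of two charges on the quadric along [u] agree, then the
    reflection reverses the difference of the charges. *)
Lemma quadric_refl_anti u (mu nu : {charge set 'rV[R]_d -> \bar R}) :
  Q u <> 0 -> supported_in mu S -> supported_in nu S ->
  charge_eq (pushforward mu (proj_hyperplane u))
            (pushforward nu (proj_hyperplane u)) ->
  forall B, measurable B -> (mu B + mu (quadric_refl u @^-1` B) =
    nu B + nu (quadric_refl u @^-1` B))%E.
Proof.
move=> Qu muS nuS E; apply: charge_invariant_anti.
- by apply: continuous_measurable_rV; exact: continuous_refl.
- move=> x; have sN : slope u (quadric_refl u x) = - slope u x.
    by rewrite quadric_reflE -scaleNr slopeD; field; apply/eqP.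
  rewrite [LHS]quadric_reflE sN quadric_reflE -addrA -opprD -scalerDl.
  by rewrite mulrN mulNr subrr scale0r subr0.
- move=> C mC TC.
  have mD : measurable (section u @^-1` C).
    by rewrite -[X in measurable X]setTI; exact: measurable_section.
  have mPD : measurable (proj_hyperplane u @^-1` (section u @^-1` C)).
    by rewrite -[X in measurable X]setTI; exact: measurable_proj_hyperplane.
  have CS : C `&` S = (proj_hyperplane u @^-1` (section u @^-1` C)) `&` S.
    apply/seteqP; split => x [Cx Sx]; split => //=.
      by have [->//|->] := section_proj Qu Sx; rewrite -TC in Cx.
    move: Cx => /=; have [->//|->] := section_proj Qu Sx.
    by move=> h; rewrite -TC.
  rewrite (supported_in_eq muS mC mPD CS) (supported_in_eq nuS mC mPD CS).
  exact: (E _ mD).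
Qed.

End quadric.

Lemma unit_sphere_scale {R : realType} {d : nat} (u1 u2 : 'rV[R]_d) :
  unit_sphere u1 -> unit_sphere u2 -> u1 <> u2 -> u1 <> - u2 ->
  forall c, u1 <> c *: u2.
Proof.
move=> n1 n2 u12 u12' c E; move: n1; rewrite /unit_sphere/= E enormZ n2 mulr1.
move/eqP; rewrite eqr_norml ler01 andbT => /orP[]/eqP c1.
  by apply: u12; rewrite E c1 scale1r.
by apply: u12'; rewrite E c1 scaleN1r.
Qed.

Unset Implicit Arguments.

Theorem theorem1p3 (R : realType) (d : nat) (hd : (2 <= d)%N)
    (Q : 'rV[R]_d -> R) (hQ : quadratic_form Q) (v : 'rV[R]_d) (rho : R) :
  exists E : set ('rV[R]_d * 'rV[R]_d),
    [/\ E `<=` unit_sphere `*` unit_sphere,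
        (surface_measure d \x surface_measure d)%E.-negligible E &
        forall u1 u2 : 'rV[R]_d,
          unit_sphere u1 -> unit_sphere u2 -> u1 <> u2 -> u1 <> - u2 ->
          Q u1 <> 0 -> Q u2 <> 0 -> ~ E (u1, u2) ->
          forall mu nu : {charge set 'rV[R]_d -> \bar R},
            supported_in mu (quadric Q v rho) ->
            supported_in nu (quadric Q v rho) ->
            charge_eq (pushforward mu (proj_hyperplane u1))
                      (pushforward nu (proj_hyperplane u1)) ->
            charge_eq (pushforward mu (proj_hyperplane u2))
                      (pushforward nu (proj_hyperplane u2)) ->
            charge_eq mu nu].
Proof.
have [A symA QE] := hQ.
have {QE}-> : Q = (fun x => bform A x x).
  by apply/funext => x; rewrite QE bformE.
exists ((unit_sphere `*` unit_sphere) `&` exceptional_pairs A); split.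
- exact: subIsetl.
- by apply: negligibleS (exceptional_pairs_null symA); exact: subIsetr.
move=> u1 u2 n1 n2 u12 u12' Q1 Q2 Eu mu nu muS nuS E1 E2.
have anti1 := quadric_refl_anti symA Q1 muS nuS E1.
have anti2 := quadric_refl_anti symA Q2 muS nuS E2.
have [al [be ab]] := charge_diff_measures mu nu.
have anti (T : 'rV[R]_d -> 'rV[R]_d) : measurable_fun setT T ->
  (forall B, measurable B -> (mu B + mu (T @^-1` B) = nu B + nu (T @^-1` B))%E) ->
  forall B, measurable B -> (al B + al (T @^-1` B) = be B + be (T @^-1` B))%E.
  move=> mT H B mB; apply: (charge_diff_anti mB _ ab (H B mB)).
  by rewrite -[X in measurable X]setTI; exact: mT.
have mT u : measurable_fun setT (quadric_refl A v u).
  by apply: continuous_measurable_rV; exact: continuous_refl.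
(* the trace of the product of the two reflections is this number minus 2 *)
have ab4 : dotp u2 (quadric_normal A u1) * dotp u1 (quadric_normal A u2) =
    4 * bform A u1 u2 ^+ 2 / (bform A u1 u1 * bform A u2 u2).
  rewrite !dotp_quadric_normal (bformC symA u2 u1).
  by field; apply/andP; split; apply/eqP.
have albe := eq_measure_two_reflections _ _
  (anti _ (mT u1) anti1) (anti _ (mT u2) anti2) (unit_sphere_scale n1 n2 u12 u12').
move=> B mB; have := ab B mB; rewrite albe//; last 3 first.
- by rewrite dotp_quadric_normal; field; apply/eqP.
- by rewrite dotp_quadric_normal; field; apply/eqP.
- move=> c th cth E; apply: Eu; split; first by [].
  exists c; first exact: cth.
  split; first exact/eqP.
  have QQ : bform A u1 u1 * bform A u2 u2 != 0.
    by rewrite mulf_neq0//; apply/eqP.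
  by rewrite /= -/th -mulrA -E ab4 divfK.
have fb : be B \is a fin_num by exact: fin_num_measure.
have fm : mu B \is a fin_num by exact: fin_num_measure.
have fn : nu B \is a fin_num by exact: fin_num_measure.
rewrite -(fineK fm) -(fineK fn) -(fineK fb) -!EFinD => -[] h; congr EFin; lra.
Qed.
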